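(* Let $\alpha,\beta>-1$ and $n\ge1$ an integer. The Hankel determinant $D_n(\lambda,\alpha,\beta)$ satisfies $$D_n(\lambda,\alpha,\beta)=D_n(0,\alpha,\beta)\exp\left[\int_0^{\lambda}\frac{-\sigma_n(-s,\alpha,\beta)-ns-n(n+\beta)}{s}\,ds\right]$$ and, as $\lambda\to0$, $$D_n(\lambda,\alpha,\beta)=D_n(0,\alpha,\beta)\exp\left[b_1\lambda+\frac{b_2}{2}\lambda^2+\frac{b_3}{3}\lambda^3+\frac{b_4}{4}\lambda^4+\frac{b_5}{5}\lambda^5+O(\lambda^6)\right],$$ where $b_m=b_m(n,\alpha,\beta)$ are as in the context (whenever the displayed denominators are nonzero), and $$D_n(0,\alpha,\beta)=\frac1{n!}\prod_{j=0}^{n-1}\frac{\Gamma(j+2)\Gamma(j+\alpha+1)\Gamma(j+\beta+1)}{\Gamma(n+j+\alpha+\beta+1)}=G(n+1)\frac{G(n+\alpha+1)G(n+\beta+1)G(n+\alpha+\beta+1)}{G(\alpha+1)G(\beta+1)G(2n+\alpha+\beta+1)},$$ with $G$ the Barnes $G$-function.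
   Context: $D_n(\lambda,\alpha,\beta)=\det\left(\int_0^1x^{j+k}x^{\alpha}(1-x)^{\beta}e^{-\lambda x}\,dx\right)_{j,k=0}^{n-1}$, $\lambda\in\mathbb{R}$. $P_n(x,\lambda)=x^n+p(n,\lambda)x^{n-1}+\cdots$ is the monic orthogonal polynomial of degree $n$ with respect to $x^{\alpha}(1-x)^{\beta}e^{-\lambda x}$ on $[0,1]$, and $\sigma_n(\lambda,\alpha,\beta):=n\lambda+\lambda\,p(n,-\lambda)-n(n+\beta)$. The Barnes $G$-function satisfies $G(z+1)=\Gamma(z)G(z)$, $G(1)=1$. Write $A=2n+\alpha+\beta$ and $g=n(\alpha+n)(\beta+n)(\alpha+\beta+n)$. The coefficients are $$b_1=-\frac{n(\alpha+n)}{A},\qquad b_2=\frac{g}{(A-1)A^2(A+1)},\qquad b_3=\frac{(\alpha-\beta)(\alpha+\beta)\,g}{(A-2)(A-1)A^3(A+1)(A+2)},$$ $$b_4=\frac{g\,F}{A^4(A-3)(A-2)(A-1)^2(A+1)^2(A+2)(A+3)},$$ $$b_5=\frac{(\alpha-\beta)(\alpha+\beta)\,g\,E}{A^5(A-4)(A-3)(A-2)(A-1)^2(A+1)^2(A+2)(A+3)(A+4)},$$ with $$\begin{aligned}F={}&(\alpha+\beta-1)(\alpha+\beta)^2(\alpha+\beta+1)(\alpha^2-3\alpha\beta+\beta^2+1)-n^4(8\alpha^2+8\beta^2-4)\\&-8n^3(\alpha+\beta)(2\alpha^2+2\beta^2-1)-2n^2\big[3\alpha^4+12\alpha^3\beta+\alpha^2(18\beta^2-7)+6\alpha\beta(2\beta^2-1)+3\beta^4-7\beta^2+2\big]\\&+2n(\alpha+\beta)\big[\alpha^4-4\alpha^3\beta+\alpha^2(5-10\beta^2)+\alpha(2\beta-4\beta^3)+\beta^4+5\beta^2-2\big],\end{aligned}$$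 $$\begin{aligned}E={}&(\alpha+\beta-1)(\alpha+\beta)^2(\alpha+\beta+1)(\alpha^2-5\alpha\beta+\beta^2+5)+16n^6+48n^5(\alpha+\beta)\\&+4n^4(7\alpha^2+30\alpha\beta+7\beta^2-6)-8n^3\big[(3\alpha-\beta)(\alpha-3\beta)+6\big](\alpha+\beta)\\&-2n^2\big[(14\alpha^2-11)\beta^2+18\alpha(\alpha^2+2)\beta+11\alpha^2(\alpha^2-1)+18\alpha\beta^3+11\beta^4+10\big]\\&-2n(\alpha+\beta)\big[\alpha^4+10\alpha^3\beta+\alpha^2(18\beta^2-23)+2\alpha\beta(5\beta^2+6)+\beta^4-23\beta^2+10\big].\end{aligned}$$ *)

(* Defs.v *)
From HB Require Import structures.
From mathcomp Require Import all_boot all_order all_algebra.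
From mathcomp Require Import all_classical all_reals all_analysis.

Set Implicit Arguments.
Unset Strict Implicit.
Unset Printing Implicit Defensive.

Import Order.TTheory GRing.Theory Num.Theory.
Import numFieldNormedType.Exports.

Local Open Scope classical_set_scope.
Local Open Scope ring_scope.

(* The integral from a to b, with the usual sign convention when b < a. *)
Definition oriented_integral (R : realType) (a b : R) (f : R -> R) : R :=
  if a <= b then \int[lebesgue_measure]_(x in `[a, b]) f x
  else - \int[lebesgue_measure]_(x in `[b, a]) f x.

(* [powR] gives the weight a finite junk value at the endpoints 0 and 1 when an
   exponent is negative; this does not affect the integrals over [0, 1]. *)
Definition weight (R : realType) (lambda alpha beta x : R) : R :=
  x `^ alpha * (1 - x) `^ beta * expR (- lambda * x).

Definition hankel_matrix (R : realType) (n : nat) (lambda alpha beta : R) :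
    'M[R]_n :=
  \matrix_(j < n, k < n) \int[lebesgue_measure]_(x in `[0%R, 1%R])
    (x ^+ (j + k) * weight lambda alpha beta x).

Definition hankel_det (R : realType) (n : nat) (lambda alpha beta : R) : R :=
  \det (hankel_matrix n lambda alpha beta).

Definition is_monic_orthogonal (R : realType) (n : nat)
    (lambda alpha beta : R) (p : {poly R}) : Prop :=
  [/\ p \is monic, size p = n.+1 &
    forall q : {poly R}, (size q <= n)%N ->
      \int[lebesgue_measure]_(x in `[0%R, 1%R])
        (p.[x] * q.[x] * weight lambda alpha beta x) = 0].

Definition monic_orthogonal (R : realType) (n : nat)
    (lambda alpha beta : R) : {poly R} :=
  xget 0 [set p | is_monic_orthogonal n lambda alpha beta p].

(* The coefficient p(n, lambda) of x^(n-1); only meaningful for 0 < n. *)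
Definition subleading (R : realType) (n : nat) (lambda alpha beta : R) : R :=
  (monic_orthogonal n lambda alpha beta)`_n.-1.

Definition sigma (R : realType) (n : nat) (lambda alpha beta : R) : R :=
  n%:R * lambda + lambda * subleading n (- lambda) alpha beta
  - n%:R * (n%:R + beta).

(* Euler's integral, convergent for 0 < z. *)
Definition Gamma (R : realType) (z : R) : R :=
  \int[lebesgue_measure]_(t in `]0%R, +oo[) (t `^ (z - 1) * expR (- t)).

Definition euler_gamma (R : realType) : R :=
  limn (fun N : nat => (\sum_(1 <= k < N.+1) k%:R^-1) - ln N%:R : R).

(* Canonical Weierstrass product: with z = 1 + w,
   G(1 + w) = (2 pi)^(w/2) exp(- (w + (1 + gamma) w^2) / 2)
              prod_(k >= 1) (1 + w/k)^k exp(w^2 / (2k) - w).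
   It is the entire function with G(1) = 1 and G(z + 1) = Gamma(z) G(z) that is
   known as the Barnes G-function; those two equations alone do not determine
   it. *)
Definition barnesG (R : realType) (z : R) : R :=
  let w := z - 1 in
  (2 * pi) `^ (w / 2) *
  expR (- ((w + (1 + euler_gamma R) * w ^+ 2) / 2)) *
  limn (fun N : nat => \prod_(1 <= k < N.+1)
    ((1 + w / k%:R) ^+ k * expR (w ^+ 2 / (2 * k%:R) - w)) : R).

Section Coefficients.
Context {R : realType}.
Variables (n' : nat) (a b : R).
Let n : R := n'%:R.
Let A : R := 2 * n + a + b.
Let g : R := n * (a + n) * (b + n) * (a + b + n).

Definition polyF : R :=
  (a + b - 1) * (a + b) ^+ 2 * (a + b + 1) * (a ^+ 2 - 3 * a * b + b ^+ 2 + 1)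
  - n ^+ 4 * (8 * a ^+ 2 + 8 * b ^+ 2 - 4)
  - 8 * n ^+ 3 * (a + b) * (2 * a ^+ 2 + 2 * b ^+ 2 - 1)
  - 2 * n ^+ 2 * (3 * a ^+ 4 + 12 * a ^+ 3 * b + a ^+ 2 * (18 * b ^+ 2 - 7)
                  + 6 * a * b * (2 * b ^+ 2 - 1) + 3 * b ^+ 4 - 7 * b ^+ 2 + 2)
  + 2 * n * (a + b) * (a ^+ 4 - 4 * a ^+ 3 * b + a ^+ 2 * (5 - 10 * b ^+ 2)
                       + a * (2 * b - 4 * b ^+ 3) + b ^+ 4 + 5 * b ^+ 2 - 2).

Definition polyE : R :=
  (a + b - 1) * (a + b) ^+ 2 * (a + b + 1) * (a ^+ 2 - 5 * a * b + b ^+ 2 + 5)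
  + 16 * n ^+ 6 + 48 * n ^+ 5 * (a + b)
  + 4 * n ^+ 4 * (7 * a ^+ 2 + 30 * a * b + 7 * b ^+ 2 - 6)
  - 8 * n ^+ 3 * ((3 * a - b) * (a - 3 * b) + 6) * (a + b)
  - 2 * n ^+ 2 * ((14 * a ^+ 2 - 11) * b ^+ 2 + 18 * a * (a ^+ 2 + 2) * b
                  + 11 * a ^+ 2 * (a ^+ 2 - 1) + 18 * a * b ^+ 3
                  + 11 * b ^+ 4 + 10)
  - 2 * n * (a + b) * (a ^+ 4 + 10 * a ^+ 3 * b + a ^+ 2 * (18 * b ^+ 2 - 23)
                       + 2 * a * b * (5 * b ^+ 2 + 6) + b ^+ 4
                       - 23 * b ^+ 2 + 10).

Definition b1_den : R := A.
Definition b2_den : R := (A - 1) * A ^+ 2 * (A + 1).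
Definition b3_den : R :=
  (A - 2) * (A - 1) * A ^+ 3 * (A + 1) * (A + 2).
Definition b4_den : R :=
  A ^+ 4 * (A - 3) * (A - 2) * (A - 1) ^+ 2 * (A + 1) ^+ 2 * (A + 2) * (A + 3).
Definition b5_den : R :=
  A ^+ 5 * (A - 4) * (A - 3) * (A - 2) * (A - 1) ^+ 2 * (A + 1) ^+ 2
  * (A + 2) * (A + 3) * (A + 4).

Definition b1 : R := - (n * (a + n) / b1_den).
Definition b2 : R := g / b2_den.
Definition b3 : R := (a - b) * (a + b) * g / b3_den.
Definition b4 : R := g * polyF / b4_den.
Definition b5 : R := (a - b) * (a + b) * g * polyE / b5_den.

End Coefficients.

(* Main.v *)
(* The measure x^alpha (1-x)^beta e^(-lambda x) dx has moments m_k with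
   m_k' = - m_(k+1).  Writing D_n as the product of the squared norms of the
   monic orthogonal polynomials P_0, ..., P_(n-1), this gives
   (log D_n)' = p(n, .) and, for the recurrence coefficients, the Toda equations
   p(n, .)' = beta_n, beta_n' = beta_n (alpha_(n-1) - alpha_n) and
   alpha_n' = beta_n - beta_(n+1).  Hence the first five logarithmic derivatives
   of D_n at 0 are polynomials in the Jacobi recurrence coefficients, and these
   are found from the subleading coefficients of the P_n: the second-order
   operator q |-> x (1-x) q'' + (alpha+1 - (alpha+beta+2) x) q' is symmetric,
   so the P_n are its eigenvectors.

   At lambda = 0 the squared norm of P_n is a quotient of Gamma values, as the
   Jacobi beta_n is rational and that of P_0 is B(alpha+1, beta+1).  That
   B(a, b) = Gamma a Gamma b / Gamma (a + b) follows because both sides obey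
   one recurrence in a and agree in the limit a -> oo; G(z+1) = Gamma(z) G(z)
   is obtained by telescoping the Weierstrass product, its constant being fixed
   by the duplication formula at the integers. *)

Require Import Defs.
From HB Require Import structures.
From mathcomp Require Import all_boot all_order all_algebra.
From mathcomp Require Import all_classical all_reals all_analysis.
From mathcomp Require Import measurable_realfun zify ring lra.

Set Implicit Arguments.
Unset Strict Implicit.
Unset Printing Implicit Defensive.

Import Order.TTheory GRing.Theory Num.Theory.

Local Open Scope ring_scope.

(** * Orthogonal polynomials of a moment functional *)

Section OrthogonalPolynomials.
Context {R : realFieldType}.
Implicit Types (p q r : {poly R}) (m : nat -> R).

(** The algebra is done for an abstract functional known only through its moments and the positivity
    of L(p^2). Every recurrence coefficient is then a quotient of moment expressions with positive
    denominator, so its differentiability in lambda follows from that of the moments, for all lambda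
    at once. What shapes the statements is degeneracy at small index. The closed form of beta_1
    breaks down when alpha+beta = -1, that of alpha_0 - alpha_1 when alpha+beta = 0, and
    Gamma(alpha+beta+1) may lie outside the range of Euler's integral. The expansion is protected by
    the nonvanishing denominators; the formulas for D_n(0), which carry no such assumption, start at
    n = 1 with beta_1 computed apart. For n = 1 the coefficients with index n-1 = 0 are given values
    that keep the Toda equations true. The order of the remainder costs little: only
    differentiability of the fifth logarithmic derivative at 0 is required. For Barnes' G,
    duplication replaces Stirling's formula: comparing the product at N and at 2N gives L = c L^2
    for its limit L at w = 1, and positivity of L determines it. *)

Definition moment_functional m p : R := \sum_(i < size p) p`_i * m i.

Lemma moment_functional_widen m N p : (size p <= N)%N ->
  moment_functional m p = \sum_(i < N) p`_i * m i.
Proof.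
move=> pN; rewrite /moment_functional (big_ord_widen N (fun i => p`_i * m i))//.
rewrite big_mkcond/=; apply: eq_bigr => i _; case: ltnP => // h.
by rewrite nth_default ?mul0r.
Qed.

Fact moment_functional_linear m : linear (moment_functional m : {poly R} -> R^o).
Proof.
move=> c p q; pose N := maxn (size p) (size q).
have hp : (size p <= N)%N by rewrite leq_maxl.
have hq : (size q <= N)%N by rewrite leq_maxr.
rewrite !(@moment_functional_widen m N)//; last first.
  rewrite (leq_trans (size_polyD _ _))// geq_max hq andbT.
  by rewrite (leq_trans (size_scale_leq _ _)).
rewrite scaler_sumr -big_split/=; apply: eq_bigr => i _.
by rewrite coefD coefZ mulrDl -mulrA.
Qed.
HB.instance Definition _ m :=
  GRing.isLinear.Build R {poly R} R^o _ (moment_functional m) (moment_functional_linear m).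

Lemma moment_functionalXn m k : moment_functional m 'X^k = m k.
Proof.
rewrite (@moment_functional_widen _ k.+1) ?size_polyXn//.
rewrite big_ord_recr/= coefXn eqxx mul1r big1 ?add0r// => i _.
by rewrite coefXn ltn_eqF ?mul0r.
Qed.

(* The pair of consecutive monic orthogonal polynomials (P_n, P_(n-1)), with
   P_(-1) = 0: division by zero then makes the first off-diagonal recurrence
   coefficient vanish. *)
Fixpoint op_pair m n : {poly R} * {poly R} :=
  if n is k.+1 then
    let: (p, q) := op_pair m k in
    let hp := moment_functional m (p * p) in
    (('X - (moment_functional m ('X * p * p) / hp)%:P) * p
      - (hp / moment_functional m (q * q)) *: q, p)
  else (1, 0).

Definition op m n := (op_pair m n).1.
Definition op_prev m n := if n is k.+1 then op m k else 0.
Definition op_norm m n := moment_functional m (op m n * op m n).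
Definition op_alpha m n := moment_functional m ('X * op m n * op m n) / op_norm m n.
Definition op_beta m n := if n is k.+1 then op_norm m n / op_norm m k else 0.

Lemma op0 m : op m 0 = 1. Proof. by []. Qed.

Lemma opS m n : op m n.+1 = ('X - (op_alpha m n)%:P) * op m n
  - op_beta m n *: op_prev m n.
Proof.
rewrite /op_alpha /op_beta /op_norm /op_prev /op /=.
case: n => [|n]/=; first by rewrite !scaler0.
by case: (op_pair m n).
Qed.

Context {m : nat -> R}.
Hypothesis m_pos : forall p, p != 0 -> 0 < moment_functional m (p * p).
Local Notation L := (moment_functional m).
Local Notation P := (op m).

Lemma size_opB n : (size (P n) = n.+1) * (P n \is monic).
Proof.
suff: (size (P n) = n.+1 /\ P n \is monic) /\ (size (op_prev m n) <= n)%N.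
  by case=> -[].
elim: n => [|n [[IH1 IH2] IH3]]; first by rewrite op0 size_poly1 monic1 size_poly0.
have s1 : size (('X - (op_alpha m n)%:P) * P n)%R = n.+2.
  by rewrite size_Mmonic ?polyXsubC_eq0// size_XsubC IH1.
have s2 : (size (- (op_beta m n *: (op_prev m n))) < n.+2)%N.
  rewrite size_polyN (leq_ltn_trans (size_scale_leq _ _))//.
  by rewrite (leq_ltn_trans IH3).
rewrite opS; split; last by rewrite IH1.
split; first by rewrite size_polyDl s1.
rewrite monicE lead_coefDl ?s1//.
by rewrite -monicE monicMl// monicXsubC.
Qed.

Lemma size_op n : size (P n) = n.+1. Proof. exact: (size_opB n).1. Qed.
Lemma op_monic n : P n \is monic. Proof. exact: (size_opB n).2. Qed.
Lemma op_neq0 n : P n != 0. Proof. exact/monic_neq0/op_monic. Qed.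
Lemma op_norm_gt0 n : 0 < op_norm m n. Proof. exact/m_pos/op_neq0. Qed.
Lemma coef_op_lead n : (P n)`_n = 1.
Proof. by have := op_monic n; rewrite monicE /lead_coef size_op => /eqP. Qed.

Lemma size_sub_op n q : (size q <= n.+1)%N -> (size (q - q`_n *: P n)%R <= n)%N.
Proof.
move=> qn; apply/leq_sizeP => j; rewrite leq_eqVlt => /predU1P[<-|nj].
  by rewrite coefB coefZ coef_op_lead mulr1 subrr.
rewrite coefB coefZ [q`_j]nth_default ?(leq_trans qn)//.
by rewrite [(P n)`_j]nth_default ?size_op// mulr0 subr0.
Qed.

(** Removing the multiple of [P n] with the same top coefficient leaves a polynomial of lower
    degree. Orthogonality is a hypothesis here because the induction for [op_orth] already uses this
    fact at earlier orders. *)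
Let orth_lead n : (forall q, (size q <= n)%N -> L (P n * q) = 0) ->
  forall q, (size q <= n.+1)%N -> L (P n * q) = q`_n * op_norm m n.
Proof.
move=> Pn q qn; rewrite -{1}[q](subrK (q`_n *: P n)) mulrDr linearD/=.
by rewrite Pn ?size_sub_op// add0r -scalerAr linearZ.
Qed.

Lemma moment_functional_opS n q : L (P n.+1 * q) =
  L ('X * P n * q) - op_alpha m n * L (P n * q) - op_beta m n * L (op_prev m n * q).
Proof.
by rewrite opS mulrBl linearB/= mulrBl mulrBl linearB/= mul_polyC -!scalerAl !linearZ.
Qed.

(** Two consecutive orders are carried through the induction, as the recurrence involves both. The
    definition of [op_alpha] makes [P n.+1] orthogonal to [P n], that of [op_beta] makes it
    orthogonal to lower degrees. *)
Lemma op_orth n q : (size q <= n)%N -> L (P n * q) = 0.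
Proof.
suff: (forall q, (size q <= n)%N -> L (P n * q) = 0) /\
  (forall q, (size q <= n.-1)%N -> L (P n.-1 * q) = 0) by case=> + _; exact.
elim: n => [|n [IH1 IH2]] {q}; first by
  split=> q; rewrite leqn0 size_poly_eq0 => /eqP->; rewrite mulr0 linear0.
split=> // q qn.
have main r : (size r <= n)%N -> L (P n.+1 * r) = 0; last first.
  rewrite -[q](subrK (q`_n *: P n)) mulrDr linearD/=.
  rewrite main ?size_sub_op// add0r -scalerAr linearZ/=.
  rewrite moment_functional_opS divfK ?gt_eqF ?op_norm_gt0// subrr sub0r.
  case: n IH1 {qn main IH2} => [|n] IH1; first by rewrite mul0r oppr0 scaler0.
  by rewrite [op_prev _ _ * _]mulrC IH1 ?size_op// mulr0 oppr0 scaler0.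
move=> {q qn} rn.
(* Moving 'X from [P n] to [r] leaves the coefficient of degree n-1 of [r] times the norm of [P n];
   the [op_beta] term is the same number. *)
rewrite moment_functional_opS IH1// mulr0 subr0 -mulrA mulrCA orth_lead//; last first.
  have [->|r0] := eqVneq r 0; first by rewrite mulr0 size_poly0.
  by rewrite mulrC size_mulX.
case: n IH1 IH2 rn => [|n] IH1 IH2 rn.
  move: rn; rewrite leqn0 size_poly_eq0 => /eqP->.
  by rewrite !mulr0 coef0 mul0r linear0 mulr0 subrr.
rewrite [L (op_prev _ _ * _)]orth_lead// coefXM/=.
by rewrite /op_beta mulrCA divfK ?gt_eqF ?op_norm_gt0// subrr.
Qed.

Lemma op_orthS n q : (size q <= n.+1)%N -> L (P n * q) = q`_n * op_norm m n.
Proof. by apply: orth_lead => ?; exact: op_orth. Qed.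

Lemma op_orth_neq j k : j != k -> L (P j * P k) = 0.
Proof.
by case: ltngtP => // jk _; [rewrite mulrC|]; rewrite op_orth// size_op.
Qed.

(** The difference of two candidates has lower degree, hence is orthogonal to both and so to itself,
    and positivity forces it to vanish. *)
Lemma op_unique n q : size q = n.+1 -> q \is monic ->
  (forall r, (size r <= n)%N -> L (q * r) = 0) -> q = P n.
Proof.
move=> sq mq hq; apply/eqP; rewrite -subr_eq0; apply: contraT => /m_pos.
have s : (size (q - P n)%R <= n)%N.
  have := @size_sub_op n q; rewrite sq => /(_ (leqnn _)).
  have := mq; rewrite monicE /lead_coef sq => /eqP ->.
  by rewrite scale1r.
by rewrite {1}mulrBl linearB/= hq// op_orth// subrr ltxx.
Qed.

(** The unitriangular change of basis [T] from monomials to the [P j] has determinant 1 and turns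
    the Hankel matrix into the Gram matrix of the [P j], which is diagonal. *)
Lemma det_hankel_op n :
  \det (\matrix_(j < n, k < n) m (j + k)%N) = \prod_(j < n) op_norm m j.
Proof.
pose T : 'M[R]_n := \matrix_(j, k) (P j)`_k.
have coefsum j : (j < n)%N -> P j = \sum_(k < n) (P j)`_k *: 'X^k.
  move=> jn; apply/polyP => i; rewrite coef_sum.
  under eq_bigr do rewrite coefZ coefXn.
  have [ni|ni] := ltnP i n.
    rewrite (bigD1 (Ordinal ni))//= eqxx mulr1 big1 ?addr0// => k /negPf.
    by rewrite -val_eqE/= eq_sym => ->; rewrite mulr0.
  rewrite nth_default ?size_op ?(leq_trans jn)// big1// => k _.
  by rewrite (gtn_eqF (leq_trans (ltn_ord k) ni)) mulr0.
have dT : \det T = 1.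
  rewrite det_trig; last first.
    by apply/is_trig_mxP => i j ij; rewrite mxE nth_default// size_op.
  by rewrite big1// => i _; rewrite mxE coef_op_lead.
have -> : \det (\matrix_(j < n, k < n) m (j + k)%N) =
    \det (T *m (\matrix_(j < n, k < n) m (j + k)%N) *m T^T).
  by rewrite !det_mulmx det_tr dT mul1r mulr1.
have -> : T *m (\matrix_(j < n, k < n) m (j + k)%N) *m T^T =
    diag_mx (\row_(j < n) op_norm m j).
  apply/matrixP => i j; rewrite !mxE.
  transitivity (L (P i * P j)); last first.
    have [->|ij] := eqVneq i j; first by rewrite mulr1n.
    by rewrite mulr0n op_orth_neq.
  rewrite {1}(coefsum i)// {1}(coefsum j)// mulr_suml linear_sum/=.
  under [RHS]eq_bigr => k _.
    rewrite mulr_sumr linear_sum/=.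
    under eq_bigr => l _.
      rewrite -scalerAl -scalerAr -exprD !linearZ/= moment_functionalXn; over.
    over.
  rewrite exchange_big/=; apply: eq_bigr => k _.
  rewrite !mxE mulr_suml; apply: eq_bigr => l _; rewrite !mxE.
  by rewrite /GRing.scale/= -mulrA [_ * (P j)`_k]mulrC.
by rewrite det_diag; apply: eq_bigr => i _; rewrite mxE.
Qed.

End OrthogonalPolynomials.

(** * Jacobi recurrence coefficients *)

(** Each side condition left by [field] is matched with a nonvanishing hypothesis that equals it
    only up to [ring]. *)
Ltac nonzero_field :=
  field; repeat (apply/andP; split);
  match goal with
  | H : is_true (negb (eq_op ?x _)) |- is_true (negb (eq_op ?y _)) =>
    replace y with x by ring; exact H
  end.

Lemma eq_of_subr_eq {V : zmodType} (x y u v : V) : u = v -> x - y = u - v -> x = y.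
Proof. by move=> ->; rewrite subrr => /subr0_eq. Qed.

(* In terms of A = 2n + a + b, c = a + b and d = a - b, the Jacobi recurrence
   coefficients are beta_n = jac_beta c d A and
   alpha_(n-1) - alpha_n = jac_dalpha c d A; incrementing n shifts A by 2. *)
Definition jac_beta {R : fieldType} (c d A : R) : R :=
  (A ^+ 2 - c ^+ 2) * (A ^+ 2 - d ^+ 2) / (16 * ((A - 1) * A ^+ 2 * (A + 1))).
Definition jac_dalpha {R : fieldType} (c d A : R) : R :=
  2 * d * c / ((A - 2) * A * (A + 2)).

Section RecurrenceCoefficients.
Context {R : realFieldType}.
Context {m : nat -> R}.
Hypothesis m_pos : forall p, p != 0 -> 0 < moment_functional m (p * p).
Local Notation L := (moment_functional m).
Local Notation P := (op m).

(** Multiplying by 'X expresses the coefficient of degree n-1 without truncated subtraction: it is 0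
    at n = 0, so the recurrence holds uniformly. The factor 'X^2 below plays the same role for
    degree n-2. *)
Lemma op_subleadingS n : ('X * P n.+1)`_n.+1 = ('X * P n)`_n - op_alpha m n.
Proof.
rewrite coefXM/= opS coefB mulrBl coefB coefZ mul_polyC coefZ coef_op_lead// mulr1.
rewrite [(op_prev m n)`_n](_ : _ = 0) ?mulr0 ?subr0//.
by rewrite /op_prev; case: n => [|n]; rewrite ?coef0// nth_default// size_op.
Qed.

Lemma op_subsubleadingS n : ('X^2 * P n.+1)`_n.+1 =
  ('X^2 * P n)`_n - op_alpha m n * ('X * P n)`_n - op_beta m n.
Proof.
have -> : ('X^2 * P n.+1)`_n.+1 = ('X * P n.+1)`_n.
  by rewrite expr2 -mulrA [LHS]coefXM.
rewrite opS mulrBr coefB mulrBl mulrBr coefB mulrA -expr2 mul_polyC -!scalerAr !coefZ.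
congr (_ - _ - _); case: n => [|n]; first by rewrite mul0r.
by rewrite coefXM/= coef_op_lead// mulr1.
Qed.

Context {a b : R}.
Hypothesis a_gtN1 : -1 < a.
Hypothesis b_gtN1 : -1 < b.
Hypothesis m_rec : forall k, (a + 1 + k%:R) * m k = (a + b + 2 + k%:R) * m k.+1.

(* Pearson equation: (x (1 - x) w)' = ((a + 1) - (a + b + 2) x) w for the weight
   w = x^a (1 - x)^b. *)
Let pearson (u : {poly R}) :=
  'X * (1 - 'X) * u^`() + ((a + 1)%:P - (a + b + 2) *: 'X) * u.

Let coef_pearson u k :
  (pearson u)`_k = (k%:R + a + 1) * u`_k - (k%:R + a + b + 1) * ('X * u)`_k.
Proof.
have -> : pearson u = 'X * u^`() - 'X * ('X * u^`()) + (a + 1)%:P * u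
    - (a + b + 2) *: ('X * u).
  by rewrite /pearson mulrBl -scalerAl; ring.
rewrite coefB coefZ coefD coefCM coefB !coefXM coef_deriv.
case: k => [|[|k]]/=; rewrite ?coef_deriv/=; ring.
Qed.

(** This is the vanishing of the integral of (x (1-x) w u)', in algebraic form: by [m_rec], the two
    halves of the coefficient formula cancel after a shift of the index by one. *)
Let moment_pearson u : L (pearson u) = 0.
Proof.
have su : (size (pearson u) <= (size u).+1)%N.
  apply/leq_sizeP => j uj; rewrite coef_pearson coefXM nth_default ?(ltnW uj)//.
  by case: j uj => // j uj; rewrite nth_default// !mulr0 subr0.
rewrite (moment_functional_widen _ su).
under eq_bigr do rewrite coef_pearson mulrBl.
rewrite sumrB big_ord_recr/= nth_default// mulr0 mul0r addr0.
rewrite big_ord_recl/= coefXM/= mulr0 mul0r add0r.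
rewrite -sumrB big1// => i _; rewrite /bump/= add1n coefXM/=.
have : (i%:R + a + 1) * m i = (i.+1%:R + a + b + 1) * m i.+1.
  by have := m_rec i; rewrite -[i.+1%:R]natr1 => h; transitivity ((a + 1 + i%:R) * m i);
    [|rewrite h]; ring.
by move=> h; rewrite -mulrA mulrCA h; ring.
Qed.

Let jacobi_op (q : {poly R}) := pearson q^`().

Let moment_jacobi_op q r : L (jacobi_op q * r) = L (q * jacobi_op r).
Proof.
(* Integration by parts: [pearson] applied to u' v gives this Dirichlet form, which is visibly
   symmetric in u and v. *)
suff H u v : L (jacobi_op u * v) = - L ('X * (1 - 'X) * (u^`() * v^`())).
  by rewrite [in RHS]mulrC !H [r^`() * _]mulrC.
apply/eqP; rewrite -addr_eq0 -linearD/=; apply/eqP.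
rewrite -[RHS](moment_pearson (u^`() * v)) /jacobi_op /pearson derivM.
by congr (L _); ring.
Qed.

Let coef_jacobi_op q k : (jacobi_op q)`_k =
  (k%:R + a + 1) * (q`_k.+1 * k.+1%:R) - (k%:R + a + b + 1) * (q`_k * k%:R).
Proof.
rewrite coef_pearson coefXM !coef_deriv !mulr_natr.
by case: k => [|k]//=; rewrite ?mulr0n// coef_deriv.
Qed.

(* The operator is symmetric and preserves the degree, hence it is diagonal in
   the basis of orthogonal polynomials. *)
Let jacobi_op_eigen n :
  jacobi_op (P n) = - (n%:R * (n%:R + a + b + 1)) *: P n.
Proof.
have size_jac q : (size (jacobi_op q) <= size q)%N.
  apply/leq_sizeP => j qj; rewrite coef_jacobi_op !nth_default ?(leqW qj)//.
  by rewrite !mul0r !mulr0 subrr.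
have lead : (jacobi_op (P n))`_n = - (n%:R * (n%:R + a + b + 1)).
  rewrite coef_jacobi_op coef_op_lead// nth_default ?size_op// mul0r mulr0 sub0r.
  by rewrite mul1r mulrC.
apply/eqP; rewrite -subr_eq0; apply: contraT => /m_pos.
set D := _ - _; have sD : (size D <= n)%N.
  by rewrite /D -lead size_sub_op// (leq_trans (size_jac _))// size_op.
rewrite {1}/D mulrBl linearB/= moment_jacobi_op op_orth ?(leq_trans (size_jac _))//.
by rewrite -scalerAl linearZ/= op_orth// scaler0 subrr ltxx.
Qed.

Let coef_eigen n k : (k%:R + a + 1) * ((P n)`_k.+1 * k.+1%:R)
    - (k%:R + a + b + 1) * ((P n)`_k * k%:R)
  = - (n%:R * (n%:R + a + b + 1)) * (P n)`_k.
Proof. by rewrite -coef_jacobi_op jacobi_op_eigen coefZ. Qed.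

Let den_gt0 (x : R) : 0 <= x -> 0 < 2 * (x + 1) + a + b.
Proof. by move: a_gtN1 b_gtN1; lra. Qed.

(** The eigenvalue equation in degree n-1 is linear in this coefficient, since the leading one is
    1. *)
Lemma jacobi_subleading n :
  ('X * P n)`_n = - (n%:R * (n%:R + a) / (2 * n%:R + a + b)).
Proof.
case: n => [|n]; first by rewrite coefXM/= !mul0r oppr0.
have := coef_eigen n.+1 n; rewrite coefXM/= coef_op_lead// -![n.+1%:R]natr1.
have n0 : (0 : R) <= n%:R by [].
move: (n%:R : R) n0 => x x0 h.
have A0 : 2 * (x + 1) + a + b != 0 by rewrite gt_eqF ?den_gt0.
apply: (mulIf A0); rewrite mulNr divfK//.
by apply: (eq_of_subr_eq h); ring.
Qed.

Lemma jacobi_subsubleading n : let A := 2 * n%:R + a + b in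
  ('X^2 * P n)`_n =
  n%:R * (n%:R - 1) * (n%:R + a) * (n%:R + a - 1) / (2 * A * (A - 1)).
Proof.
case: n => [|[|n]] /=.
- by rewrite coefXnM/= !mul0r.
- by rewrite coefXnM/= subrr mulr0 !mul0r.
have -> : ('X^2 * P n.+2)`_n.+2 = (P n.+2)`_n by rewrite coefXnM/= subn2.
have h1 := jacobi_subleading n.+2; have := coef_eigen n.+2 n; move: h1.
rewrite coefXM/= -![n.+2%:R]natr1 -![n.+1%:R]natr1.
have n0 : (0 : R) <= n%:R by [].
move: (n%:R : R) n0 => x x0 pE h.
have A0 : 2 * (x + 1 + 1) + a + b != 0 by rewrite gt_eqF ?den_gt0 ?addr_ge0.
have A1 : 2 * (x + 1 + 1) + a + b - 1 != 0.
  rewrite (_ : _ - 1 = 2 * (x + 1) + a + b + 1) ; last by ring.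
  by rewrite gt_eqF// (addr_gt0 (den_gt0 x0)).
have A01 : 2 * (2 * (x + 1 + 1) + a + b) * (2 * (x + 1 + 1) + a + b - 1) != 0.
  by rewrite !mulf_neq0// pnatr_eq0.
apply: (mulIf A01); rewrite divfK//.
have E1 : 2 * (2 * (x + 1 + 1) + a + b - 1) * (P n.+2)`_n =
    (x + a + 1) * (x + 1) * - (P n.+2)`_n.+1.
  by apply: (eq_of_subr_eq h); ring.
rewrite (_ : _ * (2 * _ * _) = 2 * (2 * (x + 1 + 1) + a + b - 1) * (P n.+2)`_n
  * (2 * (x + 1 + 1) + a + b)); last by ring.
by rewrite E1 pE; field.
Qed.

(** Each [op_alpha] is a difference of consecutive subleading coefficients. The assumption bites
    only at n = 0, where a + b may vanish and the closed form is then wrong. *)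
Lemma jacobi_dalpha n : 2 * n%:R + a + b != 0 ->
  op_alpha m n - op_alpha m n.+1 = jac_dalpha (a + b) (a - b) (2 * n.+1%:R + a + b).
Proof.
have -> : op_alpha m n = ('X * P n)`_n - ('X * P n.+1)`_n.+1.
  by rewrite op_subleadingS subKr.
have -> : op_alpha m n.+1 = ('X * P n.+1)`_n.+1 - ('X * P n.+2)`_n.+2.
  by rewrite (op_subleadingS n.+1) subKr.
rewrite !jacobi_subleading /jac_dalpha -![n.+2%:R]natr1 -![n.+1%:R]natr1.
have n0 : (0 : R) <= n%:R by [].
move: (n%:R : R) n0 => x x0 A0.
have A1 : 2 * (x + 1) + a + b != 0 by rewrite gt_eqF ?den_gt0.
have A2 : 2 * (x + 1 + 1) + a + b != 0 by rewrite gt_eqF ?den_gt0 ?addr_ge0.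
by nonzero_field.
Qed.

Let op_betaE n : op_beta m n =
  ('X^2 * P n)`_n - ('X^2 * P n.+1)`_n.+1
    - (('X * P n)`_n - ('X * P n.+1)`_n.+1) * ('X * P n)`_n.
Proof. by rewrite op_subsubleadingS op_subleadingS; ring. Qed.

(** The excluded case is n = 1 with a + b = -1 (or n = 0 with a + b = 1, where both sides vanish).
    At n = 0 the closed form has a zero factor, in agreement with the convention
    [op_beta m 0 = 0]. *)
Lemma jacobi_beta n : 2 * n%:R + a + b - 1 != 0 ->
  op_beta m n = jac_beta (a + b) (a - b) (2 * n%:R + a + b).
Proof.
case: n => [_|n]; first by rewrite /jac_beta mulr0 add0r subrr !mul0r.
rewrite op_betaE !jacobi_subleading !jacobi_subsubleading /jac_beta.
rewrite -![n.+2%:R]natr1 -![n.+1%:R]natr1.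
have n0 : (0 : R) <= n%:R by [].
move: (n%:R : R) n0 => x x0 AN1.
have A1 : 2 * (x + 1) + a + b != 0 by rewrite gt_eqF ?den_gt0.
have A2 : 2 * (x + 1 + 1) + a + b != 0 by rewrite gt_eqF ?den_gt0 ?addr_ge0.
have A3 : 2 * (x + 1) + a + b + 1 != 0 by rewrite gt_eqF// (addr_gt0 (den_gt0 x0)).
have A4 : 2 * (x + 1 + 1) + a + b - 1 != 0.
  by rewrite (_ : _ - 1 = 2 * (x + 1) + a + b + 1)//; ring.
by nonzero_field.
Qed.

(** Here the factor a + b + 1 common to numerator and denominator of [jac_beta] is cancelled, so a +
    b = -1 is covered. The evaluation of the norms starts from this value. *)
Lemma jacobi_beta1 : op_beta m 1 =
  (a + 1) * (b + 1) / ((a + b + 2) ^+ 2 * (a + b + 3)).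
Proof.
rewrite op_betaE !jacobi_subleading.
have -> : ('X^2 * P 1)`_1 = 0 by rewrite coefXnM.
rewrite jacobi_subsubleading.
have A_gt0 k : 0 <= k -> a + b + 2 + k != 0.
  move=> k0; have := den_gt0 k0; rewrite mulrDr mulr1 => h.
  by rewrite gt_eqF//; move: a_gtN1 b_gtN1 k0; lra.
have A1 := A_gt0 0 (lexx 0).
have A2 := A_gt0 1 ler01.
have A3 := A_gt0 2 (ler0n _ 2).
by nonzero_field.
Qed.

End RecurrenceCoefficients.

(** * The coefficients b_2, ..., b_5 in terms of Jacobi recurrence coefficients *)

Section JacobiCumulants.
Context {R : realType}.

(** In the independent variables A, c, d every denominator is a product of shifts of A, so the side
    conditions of [field] are exactly the factors of the assumed nonzero denominator. *)
Ltac jacobi_variables n a b :=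
  move: (n%:R);
  let x := fresh "x" in let A := fresh "A" in
  let c := fresh "c" in let d := fresh "d" in
  intro x;
  set A := 2 * x + a + b;
  (have -> : x = (A - (a + b)) / 2 by rewrite /A; field);
  set c := a + b; set d := a - b;
  (have -> : a = (c + d) / 2 by rewrite /c /d; field);
  (have -> : b = (c - d) / 2 by rewrite /c /d; field);
  clearbody A c d.

Ltac split_nonzero :=
  rewrite !mulf_eq0 ?expf_eq0 /= !negb_or; intros;
  repeat match goal with
  | H : is_true (_ && _) |- _ =>
    let H1 := fresh "nz" in let H2 := fresh "nz" in case/andP: H => H1 H2
  end.

Variables (n : nat) (a b : R).
Local Notation A := (2 * n%:R + a + b).
Local Notation B := (jac_beta (a + b) (a - b)).
Local Notation D := (jac_dalpha (a + b) (a - b)).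

(** Since the exponent contains b_m lambda^m / m, the m-th logarithmic derivative at 0 is (m-1)!
    b_m: hence the factors 1, 2, 6, 24 in this and the next three identities, whose right-hand sides
    come from iterating the Toda equations. *)
Lemma b2_cumulant : b2_den n a b != 0 -> b2 n a b = B A.
Proof.
rewrite /b2 /b2_den /jac_beta.
jacobi_variables n a b.
split_nonzero.
by nonzero_field.
Qed.

Lemma b3_cumulant : b3_den n a b != 0 -> 2 * b3 n a b = B A * D A.
Proof.
rewrite /b3 /b3_den /jac_beta /jac_dalpha.
jacobi_variables n a b.
split_nonzero.
by nonzero_field.
Qed.

Lemma b4_cumulant : b4_den n a b != 0 ->
  6 * b4 n a b = B A * (D A ^+ 2 + (B (A - 2) - 2 * B A + B (A + 2))).
Proof.
rewrite /b4 /b4_den /polyF /jac_beta /jac_dalpha.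
jacobi_variables n a b.
split_nonzero.
by nonzero_field.
Qed.

Lemma b5_cumulant : b5_den n a b != 0 ->
  24 * b5 n a b = B A * (D A ^+ 3 + 3 * D A * (B (A - 2) - 2 * B A + B (A + 2))
    + (B (A - 2) * D (A - 2) - 2 * (B A * D A) + B (A + 2) * D (A + 2))).
Proof.
rewrite /b5 /b5_den /polyE /jac_beta /jac_dalpha.
jacobi_variables n a b.
split_nonzero.
by nonzero_field.
Qed.
End JacobiCumulants.

(* The lmodule structure this gives to R on itself confuses [linearZ], hence the
   late import. *)
Import numFieldNormedType.Exports.
Local Open Scope classical_set_scope.
Local Open Scope ring_scope.

(** * Dependence on the deformation parameter *)

Definition moments_at {R : realType} (m : nat -> R -> R) (x : R) := m^~ x.

Definition op_hankel {R : realType} (m : nat -> R -> R) n (x : R) :=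
  \prod_(j < n) op_norm (moments_at m x) j.

Section DeformedMoments.
Context {R : realType}.
Context {m : nat -> R -> R}.
Hypothesis m_derive : forall k (x : R), is_derive x 1 (m k) (- m k.+1 x).

Local Notation M := (moments_at m).

(* [dP] is the coefficientwise derivative of the family [P], of bounded degree. *)
Definition poly_derivable (P dP : R -> {poly R}) :=
  (forall k (x : R), is_derive x 1 (fun t => (P t)`_k) (dP x)`_k) /\
  (exists N, forall t, (size (P t) <= N)%N).

(** Constant coefficients have zero derivative. For a monic family this lowers the degree of the
    derivative, which is what makes it orthogonal to [P n]. *)
Lemma size_poly_derivable P dP N : poly_derivable P dP ->
  (forall t j, (N <= j)%N -> (P t)`_j = (P 0)`_j) -> forall t, (size (dP t) <= N)%N.
Proof.
move=> [PdP _] PN t; apply/leq_sizeP => j Nj.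
have -> := esym (@derive_val _ _ _ _ _ _ _ (PdP j t)).
rewrite (_ : (fun t => (P t)`_j) = cst (P 0)`_j) ?derive_cst//.
by apply/funext => s; rewrite PN.
Qed.

Lemma poly_derivable_cst p : poly_derivable (fun=> p) (fun=> 0).
Proof.
split=> [k x|]; last by exists (size p).
by rewrite coef0; exact: is_derive_cst.
Qed.

Lemma poly_derivableB P dP Q dQ : poly_derivable P dP -> poly_derivable Q dQ ->
  poly_derivable (fun t => P t - Q t) (fun t => dP t - dQ t).
Proof.
move=> [hP [N sP]] [hQ [K sQ]]; split=> [k x|].
  rewrite coefB (_ : (fun t => _) = (fun t => (P t)`_k) - (fun t => (Q t)`_k)).
    exact: is_deriveB.
  by apply/funext => t; rewrite coefB.
exists (maxn N K) => t; rewrite (leq_trans (size_polyD _ _))// size_polyN.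
by rewrite geq_max !leq_max sP sQ orbT.
Qed.

Lemma poly_derivableM P dP Q dQ : poly_derivable P dP -> poly_derivable Q dQ ->
  poly_derivable (fun t => P t * Q t) (fun t => dP t * Q t + P t * dQ t).
Proof.
move=> [hP [N sP]] [hQ [K sQ]]; split=> [k x|].
  rewrite coefD !coefM -big_split/=.
  rewrite (_ : (fun t => _) = \sum_(j < k.+1)
      ((fun t => (P t)`_j) * (fun t => (Q t)`_(k - j)%N))).
    apply: is_derive_eq; apply: eq_bigr => j _.
    by rewrite /GRing.scale/=; ring.
  by apply/funext => t; rewrite coefM fct_sumE.
exists (N + K)%N => t; rewrite (leq_trans (size_polyMleq _ _))//.
by rewrite (leq_trans (leq_pred _))// leq_add.
Qed.

Lemma poly_derivableZ (c dc : R -> R) P dP :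
  (forall x : R, is_derive x 1 c (dc x)) -> poly_derivable P dP ->
  poly_derivable (fun t => c t *: P t) (fun t => dc t *: P t + c t *: dP t).
Proof.
move=> hc hP.
have hC : poly_derivable (fun t => (c t)%:P) (fun t => (dc t)%:P).
  split=> [k x|]; last by exists 1%N => t; exact: size_polyC_leq1.
  case: k => [|k].
    rewrite coefC/= (_ : (fun t => _) = c)//; apply/funext => t; exact: coefC.
  rewrite coefC/= (_ : (fun t => _) = cst 0)//; first exact: is_derive_cst.
  by apply/funext => t; exact: coefC.
have := poly_derivableM hC hP.
by congr poly_derivable; apply/funext => t; rewrite ?mul_polyC.
Qed.

(** The product rule: differentiating the moments shifts their index and changes sign, which amounts
    to multiplying the polynomial by -'X. *)
Lemma is_derive_moment_functional P dP (x : R) : poly_derivable P dP ->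
  is_derive x 1 (fun t => moment_functional (M t) (P t))
    (moment_functional (M x) (dP x) - moment_functional (M x) ('X * P x)).
Proof.
move=> [hP [N sP]].
have sdP : (size (dP x) <= N)%N.
  apply: size_poly_derivable; first by split; [exact: hP|exists N].
  by move=> t j Nj; rewrite !nth_default// (leq_trans (sP _)).
have sXP : (size ('X * P x)%R <= N.+1)%N.
  have [->|P0] := eqVneq (P x) 0; first by rewrite mulr0 size_poly0.
  by rewrite mulrC size_mulX// ltnS.
rewrite (moment_functional_widen _ sdP) (moment_functional_widen _ sXP).
rewrite big_ord_recl/= coefXM/= mul0r add0r -sumrB.
rewrite (_ : (fun t => _) = \sum_(i < N) ((fun t => (P t)`_i) * m i)); last first.
  by apply/funext => t; rewrite (moment_functional_widen _ (sP t)) fct_sumE.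
apply: is_derive_eq; apply: eq_bigr => i _.
by rewrite coefXM/= /bump/= add1n /moments_at /GRing.scale/=; ring.
Qed.

Hypothesis m_pos : forall (x : R) (p : {poly R}), p != 0 ->
  0 < moment_functional (M x) (p * p).

Let norm_gt0 x n : 0 < op_norm (M x) n.
Proof. by apply: op_norm_gt0; exact: m_pos. Qed.

Let is_derive_div (f g : R -> R) (df dg x : R) : g x != 0 ->
  is_derive x 1 f df -> is_derive x 1 g dg ->
  is_derive x 1 (fun t => f t / g t) (df / g x - f x * dg / g x ^+ 2).
Proof.
move=> g0 hf hg; have hV := is_deriveV g0 hg.
rewrite (_ : (fun t => _) = f * (fun t => (g t)^-1))//.
by apply: is_derive_eq; rewrite /GRing.scale/=; field.
Qed.

(** Only existence is claimed, since the induction would give unwieldy derivatives; the explicit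
    Toda formulas are derived afterwards from orthogonality. *)
Let op_derivable2 (n : nat) :
  (exists dP, poly_derivable (fun t => op (M t) n) dP) /\
  (exists dP, poly_derivable (fun t => op_prev (M t) n) dP).
Proof.
have dX : poly_derivable (fun=> 'X) (fun=> 0) by exact: poly_derivable_cst.
have dnorm k : (exists dP, poly_derivable (fun t => op (M t) k) dP) ->
    forall x : R, exists d, is_derive x 1 (fun t => op_norm (M t) k) d.
  move=> [dP hP] x.
  by eexists; exact: is_derive_moment_functional (poly_derivableM hP hP).
suff H : forall k, (k <= n)%N -> (exists dP, poly_derivable (fun t => op (M t) k) dP).
  split; first exact: H.
  case: n H => [|n] H; last exact: H.
  by eexists; exact: (poly_derivable_cst 0).
elim: n => [|n IH] k.
  by rewrite leqn0 => /eqP->; eexists; exact: (poly_derivable_cst 1).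
rewrite leq_eqVlt ltnS => /predU1P[->|]; last exact: IH.
have [dP hP] := IH n (leqnn n).
have n0 x : op_norm (M x) n != 0 by rewrite gt_eqF.
have [dprev hprev] : exists dQ, poly_derivable (fun t => op_prev (M t) n) dQ.
  case: n IH {dP hP n0} => [|n] IH; last exact: IH.
  by eexists; exact: (poly_derivable_cst 0).
have /choice[dalpha halpha] (x : R) : exists d, is_derive x 1 (fun t => op_alpha (M t) n) d.
  have [d hd] := dnorm n (ex_intro _ _ hP) x.
  by eexists; apply: is_derive_div (is_derive_moment_functional _
    (poly_derivableM (poly_derivableM dX hP) hP)) hd.
have /choice[dbeta hbeta] (x : R) : exists d, is_derive x 1 (fun t => op_beta (M t) n) d.
  case: n IH {dP dprev hP hprev dalpha halpha} n0 => [|n] IH n0.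
    by exists 0; exact: is_derive_cst.
  have [d1 hd1] := dnorm n.+1 (IH n.+1 (leqnn _)) x.
  have [d2 hd2] := dnorm n (IH n (leqnSn _)) x.
  by eexists; apply: is_derive_div hd1 hd2; rewrite gt_eqF.
eexists; under eq_fun do rewrite opS mulrBl mul_polyC.
apply: poly_derivableB (poly_derivableZ hbeta hprev).
exact: poly_derivableB (poly_derivableM dX hP) (poly_derivableZ halpha hP).
Qed.

Let op_derivable n : exists2 dP, poly_derivable (fun t => op (M t) n) dP &
  forall x, (size (dP x) <= n)%N.
Proof.
have [[dP hP] _] := op_derivable2 n; exists dP => //.
apply: (size_poly_derivable hP) => t j.
rewrite leq_eqVlt => /predU1P[<-|nj]; first by rewrite !coef_op_lead.
by rewrite !nth_default// size_op.
Qed.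

(** The derivative of a monic [P n] has degree below n and is orthogonal to [P n], so only the
    derivative of the measure contributes. *)
Lemma is_derive_op_norm n (x : R) : is_derive x 1 (fun t => op_norm (M t) n)
  (- op_alpha (M x) n * op_norm (M x) n).
Proof.
have [dP hP sdP] := op_derivable n.
have := is_derive_moment_functional x (poly_derivableM hP hP).
move/is_derive_eq; apply.
rewrite linearD/= [dP x * _]mulrC (op_orth (m_pos _))// addr0 sub0r mulNr.
by rewrite /op_alpha divfK ?gt_eqF// mulrA.
Qed.

(* The subleading coefficient is read off the derivative of 0 = <P_n, P_(n-1)>. *)
Lemma is_derive_op_subleading n (x : R) :
  is_derive x 1 (fun t => ('X * op (M t) n)`_n) (op_beta (M x) n).
Proof.
case: n => [|n].
  rewrite (_ : (fun t => _) = cst 0); first exact: is_derive_cst.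
  by apply/funext => t; rewrite coefXM.
have [dP hP sdP] := op_derivable n.+1; have [dQ hQ sdQ] := op_derivable n.
rewrite (_ : (fun t => _) = (fun t => (op (M t) n.+1)`_n)); last first.
  by apply/funext => t; rewrite coefXM.
apply: is_derive_eq (hP.1 n x) _.
have := is_derive_moment_functional x (poly_derivableM hP hQ).
have -> : (fun t => moment_functional (M t) (op (M t) n.+1 * op (M t) n)) = cst 0.
  by apply/funext => t; rewrite (op_orth (m_pos _))// size_op.
move=> /(@derive_val _ _ _ _ _ _ _); rewrite derive_cst linearD/=.
rewrite [dP x * _]mulrC (op_orthS (m_pos _))// (op_orth (m_pos _)) ?(leq_trans (sdQ _))// addr0.
have -> : 'X * (op (M x) n.+1 * op (M x) n) = op (M x) n.+1 * ('X * op (M x) n).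
  by rewrite mulrCA.
rewrite (op_orthS (m_pos _)); last by rewrite mulrC size_mulX ?size_op ?op_neq0.
rewrite coefXM/= coef_op_lead mul1r => /esym/eqP; rewrite subr_eq0 => /eqP <-.
by rewrite mulfK// gt_eqF.
Qed.

Lemma is_derive_op_alpha n (x : R) : is_derive x 1 (fun t => op_alpha (M t) n)
  (op_beta (M x) n - op_beta (M x) n.+1).
Proof.
rewrite (_ : (fun t => _) =
    (fun t => ('X * op (M t) n)`_n) - (fun t => ('X * op (M t) n.+1)`_n.+1)).
  by apply: is_deriveB; exact: is_derive_op_subleading.
apply/funext => t; rewrite -[LHS](subKr ('X * op (M t) n)`_n).
by rewrite -op_subleadingS.
Qed.

(** The value 0 at index 0 is a placeholder: it is only ever multiplied by [op_beta u 0 = 0]. *)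
Definition op_dalpha (u : nat -> R) n :=
  if n is k.+1 then op_alpha u k - op_alpha u n else 0.

Lemma is_derive_op_dalpha n (x : R) :
  is_derive x 1 (fun t => op_dalpha (M t) n.+1)
    (op_beta (M x) n - 2 * op_beta (M x) n.+1 + op_beta (M x) n.+2).
Proof.
apply: (is_derive_eq (is_deriveB (is_derive_op_alpha n x) (is_derive_op_alpha n.+1 x))).
by ring.
Qed.

Lemma is_derive_op_beta n (x : R) : is_derive x 1 (fun t => op_beta (M t) n)
  (op_beta (M x) n * op_dalpha (M x) n).
Proof.
case: n => [|n]; first by rewrite mul0r; exact: is_derive_cst.
have h0 := norm_gt0 x n; rewrite /op_beta /op_dalpha.
have := is_derive_div (lt0r_neq0 h0) (is_derive_op_norm n.+1 x) (is_derive_op_norm n x).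
by move/is_derive_eq; apply; field; rewrite gt_eqF.
Qed.

Lemma op_hankel_gt0 n x : 0 < op_hankel m n x.
Proof. by apply: prodr_gt0 => i _. Qed.

(** Each new norm contributes the logarithmic derivative [- op_alpha], which is the increment of the
    subleading coefficient. *)
Lemma is_derive_op_hankel n (x : R) : is_derive x 1 (op_hankel m n)
  (('X * op (M x) n)`_n * op_hankel m n x).
Proof.
elim: n => [|n IH].
  rewrite /op_hankel coefXM/= mul0r (_ : (fun t => _) = cst 1).
    exact: is_derive_cst.
  by apply/funext => t; rewrite big_ord0.
rewrite (_ : op_hankel m n.+1 = op_hankel m n * (fun t => op_norm (M t) n)).
  have h := is_derive_op_norm n x.
  by apply: is_derive_eq; rewrite op_subleadingS /GRing.scale/= fctE; ring.
by apply/funext => t; rewrite /op_hankel big_ord_recr.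
Qed.

Lemma is_derive_ln_op_hankel n (x : R) :
  is_derive x 1 (fun t => ln (op_hankel m n t)) (('X * op (M x) n)`_n).
Proof.
have h0 := op_hankel_gt0 n x.
have := is_derive1_comp (is_derive1_ln h0) (is_derive_op_hankel n x).
by move/is_derive_eq; apply; rewrite mulrC mulfK// gt_eqF.
Qed.

End DeformedMoments.

(** * Taylor remainder from iterated derivatives *)

Section Taylor.
Context {R : realType}.

Definition power_bound (k : nat) (g : R -> R) :=
  exists2 C : R, 0 <= C & \forall x \near (0 : R), `|g x| <= C * `|x| ^+ k.

(** By the mean value theorem f(x) = g(c) x with |c| <= |x|, which gains one order with the same
    constant. *)
Lemma power_bound_integrate k (f g : R -> R) :
  (forall x : R, is_derive x 1 f (g x)) -> f 0 = 0 ->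
  power_bound k g -> power_bound k.+1 f.
Proof.
move=> fg f0 [C C0 /nbhs_ballP[e /= e0 gC]]; exists C => //.
apply/nbhs_ballP; exists e => //= x xe.
have cf : continuous f.
  by move=> y; apply/differentiable_continuous/derivable1_diffP.
have [c cx fx] : exists2 c, `|c| <= `|x| & f x = g c * x.
  have [x0|x0] := leP 0 x.
    have [|c] := @MVT_segment _ f g 0 x x0 (fun y _ => fg y); first exact: continuous_subspaceT.
    rewrite in_itv/= f0 !subr0 => /andP[c0 cx] ->; exists c => //.
    by rewrite !ger0_norm.
  have [|c] := @MVT_segment _ f g x 0 (ltW x0) (fun y _ => fg y); first exact: continuous_subspaceT.
  rewrite in_itv/= f0 !sub0r => /andP[xc c0] h; exists c; last first.
    by apply: oppr_inj; rewrite h mulrN.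
  by rewrite !ler0_norm ?lerN2// ltW.
rewrite fx normrM exprSr mulrA ler_wpM2r//.
have ce : ball 0 e c by move: xe; rewrite /ball/= !sub0r !normrN; exact: le_lt_trans.
by rewrite (le_trans (gC _ ce))// ler_wpM2l// lerXn2r// nnegrE.
Qed.

Lemma derivable_power_bound (f : R -> R) :
  derivable f 0 1 -> power_bound 1 (fun x => f x - f 0).
Proof.
move=> /derivableP; set d := 'D_1 f 0 => -[/cvg_ex[l hl] _].
exists (`|l| + 1); first by rewrite addr_ge0.
move/cvgrPdist_lt : hl => /(_ 1 ltr01).
rewrite near_withinE/= => h; near=> x.
have [->|x0] := eqVneq x 0; first by rewrite subrr normr0 expr1 mulr_ge0// addr_ge0.
have : x != 0 -> `|l - x^-1 *: (f (x *: 1 + 0) - f 0)| < 1 by near: x; exact: h.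
move=> /(_ x0).
rewrite addr0 {1}/GRing.scale/= [x *: 1]mulr1 => hx.
rewrite expr1 -ler_pdivrMr ?normr_gt0// -normfV -normrM mulrC.
rewrite -[_ * _](subKr l) (le_trans (ler_normB _ _))// lerD2l ltW//.
Unshelve. all: by end_near.
Qed.

(** The remainder of [f 0] is an antiderivative of the remainder of [f 1], so the order grows by one
    at each stage. Differentiability of the last function at the single point 0 starts this off with
    order 1. *)
Lemma taylor_power_bound N (f : nat -> R -> R) :
  (forall i, (i < N)%N -> forall x : R, is_derive x 1 (f i) (f i.+1 x)) ->
  derivable (f N) 0 1 ->
  power_bound N.+1 (fun x => f 0%N x - \sum_(i < N.+1) f i 0 / i`!%:R * x ^+ i).
Proof.
elim: N f => [|N IH] f fS fN.
  have := derivable_power_bound fN; congr power_bound; apply/funext => x.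
  by rewrite big_ord1 fact0 divr1 expr0 mulr1.
have := IH (fun i => f i.+1) (fun i iN => fS i.+1 iN) fN.
apply: power_bound_integrate => [x|]; last first.
  rewrite big_ord_recl/= fact0 divr1 expr0 mulr1 big1 ?addr0 ?subrr// => i _.
  by rewrite expr0n/= mulr0.
have hf := fS 0%N (ltn0Sn _) x.
rewrite (_ : (fun x => _) = f 0%N - \sum_(i < N.+2)
    (fun x => f i 0 / i`!%:R * x ^+ i)); last first.
  by apply/funext => t; rewrite !fctE/= fct_sumE.
apply: is_deriveB.
rewrite big_ord_recl/= -[X in is_derive _ _ _ X]add0r; apply: is_deriveD.
  rewrite (_ : (fun x => _) = cst (f 0%N 0)); first exact: is_derive_cst.
  by apply/funext => t; rewrite fact0 divr1 expr0 mulr1.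
apply: is_derive_sum => i; rewrite /bump/= add1n.
rewrite (_ : (fun x => _) = (f i.+1 0 / i.+1`!%:R) *: (id ^+ i.+1)); last first.
  by apply/funext => t; rewrite !fctE.
have := is_deriveZ (f i.+1 0 / i.+1`!%:R) (is_deriveX i.+1 (is_derive_id x 1)).
move=> /is_derive_eq; apply; rewrite /GRing.scale/= mulr1 factS natrM; field.
by rewrite nat1r !pnatr_eq0 -lt0n fact_gt0.
Qed.

End Taylor.

(** * Logarithmic derivatives of the Hankel determinant up to order five *)

Section Cumulants.
Context {R : realType} {m : nat -> R -> R}.
Hypothesis m_derive : forall k (x : R), is_derive x 1 (m k) (- m k.+1 x).
Local Notation M := (moments_at m).
Hypothesis m_pos : forall (x : R) (p : {poly R}), p != 0 ->
  0 < moment_functional (M x) (p * p).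

Let beta n x := op_beta (M x) n.
Let dalpha n x := op_dalpha (M x) n.
Let d2beta n x := beta n x - 2 * beta n.+1 x + beta n.+2 x.
Let d3beta n x := beta n x * dalpha n x - 2 * (beta n.+1 x * dalpha n.+1 x)
  + beta n.+2 x * dalpha n.+2 x.

(** The i-th derivative of log D_(n+1), written through the Toda equations. [d2beta] is the
    derivative of [dalpha n.+1], and [d3beta] that of [d2beta]. *)
Let cumulant n i (x : R) : R :=
  match i with
  | 0 => ln (op_hankel m n.+1 x)
  | 1 => ('X * op (M x) n.+1)`_n.+1
  | 2 => beta n.+1 x
  | 3 => beta n.+1 x * dalpha n.+1 x
  | 4 => beta n.+1 x * (dalpha n.+1 x ^+ 2 + d2beta n x)
  | _ => beta n.+1 x *
      (dalpha n.+1 x ^+ 3 + 3 * dalpha n.+1 x * d2beta n x + d3beta n x)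
  end.

Lemma op_hankel_expansion n :
  let b k := op_beta (M 0) k in let d k := op_dalpha (M 0) k in
  exists2 r : R -> R, power_bound 6 r &
  forall x, op_hankel m n.+1 x = op_hankel m n.+1 0 *
    expR (('X * op (M 0) n.+1)`_n.+1 * x + b n.+1 / 2 * x ^+ 2
      + b n.+1 * d n.+1 / 6 * x ^+ 3
      + b n.+1 * (d n.+1 ^+ 2 + (b n - 2 * b n.+1 + b n.+2)) / 24 * x ^+ 4
      + b n.+1 * (d n.+1 ^+ 3 + 3 * d n.+1 * (b n - 2 * b n.+1 + b n.+2)
          + (b n * d n - 2 * (b n.+1 * d n.+1) + b n.+2 * d n.+2)) / 120 * x ^+ 5
      + r x).
Proof.
move=> b d.
suff [r r6 rE] : exists2 r : R -> R, power_bound 6 r &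
    forall x, op_hankel m n.+1 x = op_hankel m n.+1 0 *
      expR (\sum_(i < 5) cumulant n i.+1 0 / i.+1`!%:R * x ^+ i.+1 + r x).
  exists r => // x; rewrite rE !big_ord_recr big_ord0 /= add0r.
  by rewrite !factS fact0 expr1 divr1.
(* With the Taylor remainder of the logarithm as witness, the identity is exact for every x and only
   the bound is local. *)
exists (fun x => cumulant n 0 x - \sum_(i < 6) cumulant n i 0 / i`!%:R * x ^+ i).
  have hbeta k (x : R) : is_derive x 1 (beta k) (beta k x * dalpha k x).
    exact: is_derive_op_beta.
  have hdalpha k (x : R) : is_derive x 1 (dalpha k.+1) (d2beta k x).
    exact: is_derive_op_dalpha.
  have hd2beta k (x : R) : is_derive x 1 (d2beta k) (d3beta k x).
    rewrite (_ : d2beta k = beta k - 2 *: beta k.+1 + beta k.+2)//.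
    by apply: is_derive_eq; rewrite /d3beta /GRing.scale/=; ring.
  have deriv_dalpha (k : nat) (x : R) : derivable (dalpha k) x 1.
    by case: k => [|j]; [exact: derivable_cst|have [] := hdalpha j x].
  have deriv_beta (k : nat) (x : R) : derivable (beta k) x 1 by have [] := hbeta k x.
  apply: taylor_power_bound => [i i5 x|].
    case: i i5 => [_|[_|[_|[_|[_|//]]]]] /=.
    - exact: is_derive_ln_op_hankel.
    - exact: is_derive_op_subleading.
    - exact: hbeta.
    - rewrite (_ : cumulant n 3 = beta n.+1 * dalpha n.+1)//.
      by apply: is_derive_eq; rewrite ?fctE /cumulant /GRing.scale/=; ring.
    - rewrite (_ : cumulant n 4 =
          beta n.+1 * (dalpha n.+1 * dalpha n.+1 + d2beta n))//.
      by apply: is_derive_eq; rewrite ?fctE /cumulant /GRing.scale/=; ring.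
  (* The last cumulant is only shown differentiable at 0; its derivative need not be computed. *)
  rewrite (_ : cumulant n 5 = beta n.+1 *
    (dalpha n.+1 * dalpha n.+1 * dalpha n.+1 + 3 *: (dalpha n.+1 * d2beta n) +
     (beta n * dalpha n - 2 *: (beta n.+1 * dalpha n.+1) + beta n.+2 * dalpha n.+2))).
    have d2 : derivable (d2beta n) 0 1 by have [] := hd2beta n 0.
    have db k := deriv_beta k 0; have dd k := deriv_dalpha k 0.
    exact: (derivableM (db n.+1) (derivableD
      (derivableD (derivableM (derivableM (dd n.+1) (dd n.+1)) (dd n.+1))
        (derivableZ (derivableM (dd n.+1) d2)))
      (derivableD (derivableB (derivableM (db n) (dd n))
        (derivableZ (derivableM (db n.+1) (dd n.+1))))
        (derivableM (db n.+2) (dd n.+2))))).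
  by apply/funext => x; rewrite !fctE /cumulant /d3beta /GRing.scale/=; ring.
move=> x; have h y : 0 < op_hankel m n.+1 y by exact: op_hankel_gt0.
rewrite addrC big_ord_recl /= expr0 mulr1 divr1 opprD addrA.
under [X in _ - X]eq_bigr do rewrite /bump/= add1n.
by rewrite subrK -ln_div ?posrE// lnK ?posrE ?divr_gt0// mulrC divfK ?gt_eqF.
Qed.

Lemma op_hankelE n x : \det (\matrix_(j < n, k < n) m (j + k)%N x) =
  op_hankel m n x.
Proof. exact: (det_hankel_op (m_pos x)). Qed.

End Cumulants.

(** * Improper integrals *)

Section ImproperFTC.
Context {R : realType}.
Notation mu := (@lebesgue_measure R).
Variables (D : set R) (a_ b_ : nat -> R) (F f : R -> R) (l : R).
Hypothesis ab : forall n, a_ n < b_ n.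
Hypothesis a_decr : {homo a_ : n m / (n <= m)%N >-> m <= n}.
Hypothesis b_incr : {homo b_ : n m / (n <= m)%N >-> n <= m}.
Hypothesis DE : D = \bigcup_n `[a_ n, b_ n]%classic.
Hypothesis dF : forall x, D x -> is_derive x 1 F (f x).
Hypothesis cf : forall x, D x -> {for x, continuous f}.
Hypothesis Fl : F (b_ n) - F (a_ n) @[n --> \oo] --> l.

Let itvD n x : x \in `[a_ n, b_ n] -> D x.
Proof. by move=> xn; rewrite DE; exists n. Qed.

Let mD : measurable D.
Proof. by rewrite DE; exact: bigcup_measurable. Qed.

Let FTC n : (\int[mu]_(x in `[a_ n, b_ n]) (f x)%:E = (F (b_ n) - F (a_ n))%:E)%E.
Proof.
have dFn x : x \in `[a_ n, b_ n] -> derivable F x 1.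
  by move=> /itvD/dF[].
have cF x : x \in `[a_ n, b_ n] -> {for x, continuous F}.
  by move=> xn; exact/differentiable_continuous/derivable1_diffP/dFn.
rewrite (@continuous_FTC2 _ f F)//.
- by apply: continuous_in_subspaceT => x; rewrite inE => /itvD/cf.
- split.
  + by move=> x /subset_itv_oo_cc; exact: dFn.
  + by apply: cvg_at_right_filter; apply: cF; rewrite in_itv/= lexx ltW.
  + by apply: cvg_at_left_filter; apply: cF; rewrite in_itv/= lexx ltW.
- by move=> x /subset_itv_oo_cc/itvD/dF[_]; rewrite derive1E.
Qed.

Let mfn n : measurable_fun `[a_ n, b_ n] f.
Proof.
apply/measurable_EFinP; apply: (measurable_int mu).
apply: continuous_compact_integrable; first exact: segment_compact.
by apply: continuous_in_subspaceT => x; rewrite inE => /itvD/cf.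
Qed.

Let nd_itv : nondecreasing_seq (fun n => `[a_ n, b_ n]%classic : set R).
Proof.
move=> n m nm; rewrite subsetEset => x /=; rewrite !in_itv/= => /andP[ax xb].
by rewrite (le_trans (a_decr nm))// (le_trans xb)// b_incr.
Qed.

Lemma improper_FTC_measurable : measurable_fun D f.
Proof. by rewrite DE; apply/measurable_fun_bigcup. Qed.

(** Monotone convergence along the exhausting compact intervals: the integrals are increments of [F]
    and have the finite limit [l]. *)
Lemma improper_FTC_ge0_integrable :
  (forall x, D x -> 0 <= f x) -> mu.-integrable D (EFin \o f).
Proof.
move=> f0; apply/integrableP; split.
  by apply/measurable_EFinP; exact: improper_FTC_measurable.
rewrite (_ : (\int[mu]_(x in D) _)%E = l%:E) ?ltry//.
transitivity (\int[mu]_(x in D) (f x)%:E)%E.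
  by apply: eq_integral => x; rewrite inE => /f0 fx/=; rewrite ger0_norm.
have := @ge0_nondecreasing_set_cvg_integral _ (measurableTypeR R) R
  (fun n => `[a_ n, b_ n]%classic) (EFin \o f) lebesgue_measure nd_itv.
rewrite -DE => h; apply: (cvg_unique _ (h _ _ _)) => //=.
- by move=> n; apply/measurable_EFinP; exact: mfn.
- by move=> n x /itvD/f0; rewrite lee_fin.
- by under eq_fun do rewrite FTC; apply: cvg_EFin => //; exact: nearW.
Qed.

(** For integrands of varying sign, as in integration by parts, dominated convergence with bound |f|
    replaces monotone convergence. *)
Lemma improper_FTC : mu.-integrable D (EFin \o f) -> \int[mu]_(x in D) f x = l.
Proof.
move=> fi.
pose fn n := (EFin \o f) \_ `[a_ n, b_ n]%classic.
have fn_f : (\int[mu]_(x in D) fn n x @[n --> \oo] --> \int[mu]_(x in D) (f x)%:E)%E.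
  apply: (@dominated_cvg _ _ _ mu _ mD _ _ (fun x => `|(f x)%:E|%E)) => //.
  - move=> n; apply/(measurable_restrict _ _ mD) => //.
    apply/measurable_EFinP.
    by apply: (@measurable_funS _ _ _ _ `[a_ n, b_ n]%classic) => //; exact: subIsetr.
  - move=> x Dx; have [N _ xN] : (\bigcup_n `[a_ n, b_ n]%classic) x by rewrite -DE.
    apply: cvg_near_cst; near=> n; rewrite /fn patchT// inE.
    have := @nd_itv N n; rewrite subsetEset; apply => //.
    by near: n; exact: nbhs_infty_ge.
  - exact: integrable_abse.
  - move=> n x Dx; rewrite /fn patchE; case: ifP => //.
    by rewrite abse0 abse_ge0.
have {}fn_f : ((F (b_ n) - F (a_ n))%:E @[n --> \oo] --> \int[mu]_(x in D) (f x)%:E)%E.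
  apply: cvg_trans fn_f; apply: near_eq_cvg; near=> n.
  rewrite /fn -integral_mkcondr -FTC setIidr// => x; exact: itvD.
rewrite /Rintegral (cvg_unique _ fn_f (cvg_EFin _ Fl))//.
exact: nearW.
Unshelve. all: by end_near. Qed.

End ImproperFTC.

Section UnitIntervalAndHalfLine.
Context {R : realType}.
Notation mu := (@lebesgue_measure R).
Implicit Types (F f : R -> R) (l : R).

(** Starting at 1/3 keeps [a_ n] strictly below [1 - a_ n], and below the right endpoints used on
    the half-line. *)
Let a_ n : R := n.+3%:R^-1.

Let a_gt0 n : 0 < a_ n. Proof. by rewrite invr_gt0. Qed.

Let a_le3 n : a_ n <= 3^-1.
Proof. by rewrite lef_pV2 ?posrE// ler_nat. Qed.

Let a_decr : {homo a_ : n m / (n <= m)%N >-> m <= n}.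
Proof. by move=> n m nm; rewrite lef_pV2 ?posrE// ler_nat !ltnS. Qed.

Let cvg_a : a_ n @[n --> \oo] --> (0 : R).
Proof.
have := @cvg_harmonic R; rewrite -(cvg_shiftn 2) /=.
by under eq_fun do rewrite addn2.
Qed.

Let a_small (x : R) : 0 < x -> exists n, a_ n <= x.
Proof.
move=> x0; have /cvgrPdist_le/(_ _ x0)[n _ h] := cvg_a.
by exists n; have := h n (leqnn n); rewrite /= sub0r normrN ger0_norm// ltW//.
Qed.

Let cvg_F0 F l : F x @[x --> 0^'+] --> l -> F (a_ n) @[n --> \oo] --> l.
Proof. by move=> /cvg_at_rightP; apply; split. Qed.

Section UnitInterval.
Variables (F f : R -> R) (l0 l1 : R).
Hypothesis dF : forall x : R, 0 < x < 1 -> is_derive x 1 F (f x).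
Hypothesis cf : forall x : R, 0 < x < 1 -> {for x, continuous f}.
Hypothesis F0 : F x @[x --> 0^'+] --> l0.
Hypothesis F1 : F x @[x --> 1^'-] --> l1.

Let ab n : a_ n < 1 - a_ n.
Proof. by have := a_le3 n; lra. Qed.

Let b_incr : {homo (fun n => 1 - a_ n) : n m / (n <= m)%N >-> n <= m}.
Proof. by move=> n m nm; rewrite lerD2l lerN2 a_decr. Qed.

Let DE : `]0, 1[%classic = \bigcup_n `[a_ n, 1 - a_ n]%classic.
Proof.
apply/seteqP; split => x /=.
  rewrite in_itv/= => /andP[x0 x1].
  have [n nx] := a_small x0; have [|k kx] := @a_small (1 - x); first by rewrite subr_gt0.
  exists (maxn n k) => //=; rewrite in_itv/= (le_trans _ nx) ?a_decr ?leq_maxl//=.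
  by rewrite lerBrDr addrC -lerBrDr (le_trans _ kx)// a_decr// leq_maxr.
move=> [n _ /=]; rewrite !in_itv/= => /andP[ax xb].
by rewrite (lt_le_trans (a_gt0 n) ax)/= (le_lt_trans xb)// ltrBlDr ltrDl.
Qed.

Let Fl : F (1 - a_ n) - F (a_ n) @[n --> \oo] --> l1 - l0.
Proof.
apply: cvgB; last exact: cvg_F0.
move/cvg_at_leftP : F1; apply; split=> [n|]; first by rewrite ltrBlDr ltrDl.
rewrite -[X in _ --> X]subr0; apply: cvgB => //; exact: cvg_cst.
Qed.

Let itv01 (x : R) : `]0, 1[%classic x -> 0 < x < 1. Proof. by rewrite /= in_itv. Qed.

Lemma FTC01_ge0_integrable :
  (forall x, 0 < x < 1 -> 0 <= f x) -> mu.-integrable `]0, 1[ (EFin \o f).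
Proof.
move=> f0; apply: (improper_FTC_ge0_integrable ab a_decr b_incr DE
  (fun x h => dF (itv01 h)) (fun x h => cf (itv01 h)) Fl) => x /itv01.
exact: f0.
Qed.

Lemma FTC01 : mu.-integrable `]0, 1[ (EFin \o f) ->
  \int[mu]_(x in `]0, 1[) f x = l1 - l0.
Proof.
exact: (improper_FTC ab a_decr b_incr DE
  (fun x h => dF (itv01 h)) (fun x h => cf (itv01 h)) Fl).
Qed.

End UnitInterval.

Section HalfLine.
Variables (F f : R -> R) (l0 l1 : R).
Hypothesis dF : forall x : R, 0 < x -> is_derive x 1 F (f x).
Hypothesis cf : forall x : R, 0 < x -> {for x, continuous f}.
Hypothesis F0 : F x @[x --> 0^'+] --> l0.
Hypothesis F1 : F x @[x --> +oo] --> l1.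

Let ab n : a_ n < n.+1%:R.
Proof. by rewrite (le_lt_trans (a_le3 n))// (@lt_le_trans _ _ 1)// ?ler1n//; lra. Qed.

Let b_incr : {homo (fun n => n.+1%:R : R) : n m / (n <= m)%N >-> n <= m}.
Proof. by move=> n m nm; rewrite ler_nat. Qed.

Let DE : `]0%R, +oo[%classic = \bigcup_n `[a_ n, n.+1%:R]%classic.
Proof.
apply/seteqP; split => x /=.
  rewrite in_itv/= andbT => x0.
  have [n nx] := a_small x0; have [k kx] : exists k, x <= k.+1%:R.
    exists (Num.trunc x); exact/ltW/truncnS_gt.
  exists (maxn n k) => //=; rewrite in_itv/= (le_trans _ nx) ?a_decr ?leq_maxl//=.
  by rewrite (le_trans kx)// ler_nat ltnS leq_maxr.
move=> [n _ /=]; rewrite !in_itv/= => /andP[ax xb].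
by rewrite (lt_le_trans (a_gt0 n) ax).
Qed.

Let Fl : F n.+1%:R - F (a_ n) @[n --> \oo] --> l1 - l0.
Proof.
apply: cvgB; last exact: cvg_F0.
move/cvg_pinftyP : F1; apply.
have := @cvgr_idn R; rewrite -(cvg_shiftn 1) /=.
by under eq_fun do rewrite addn1.
Qed.

Let itv0y (x : R) : `]0%R, +oo[%classic x -> 0 < x. Proof. by rewrite /= in_itv/= andbT. Qed.

Lemma FTC0y_ge0_integrable :
  (forall x, 0 < x -> 0 <= f x) -> mu.-integrable `]0%R, +oo[ (EFin \o f).
Proof.
move=> f0; apply: (improper_FTC_ge0_integrable ab a_decr b_incr DE
  (fun x h => dF (itv0y h)) (fun x h => cf (itv0y h)) Fl) => x /itv0y.
exact: f0.
Qed.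

Lemma FTC0y : mu.-integrable `]0%R, +oo[ (EFin \o f) ->
  \int[mu]_(x in `]0%R, +oo[) f x = l1 - l0.
Proof.
exact: (improper_FTC ab a_decr b_incr DE
  (fun x h => dF (itv0y h)) (fun x h => cf (itv0y h)) Fl).
Qed.

End HalfLine.
End UnitIntervalAndHalfLine.

(** * Linearity, domination and strict positivity of integrals *)

Section RintegralLemmas.
Context {R : realType}.
Notation mu := (@lebesgue_measure R).
Implicit Types (D : set R) (f g : R -> R) (a b x z : R).

Lemma integrable_lin D f g a b : measurable D ->
  mu.-integrable D (EFin \o f) -> mu.-integrable D (EFin \o g) ->
  mu.-integrable D (EFin \o (fun x => a * f x + b * g x)).
Proof.
move=> mD fi gi.
suff : mu.-integrable D (fun x => a%:E * (f x)%:E + b%:E * (g x)%:E)%E by [].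
by apply: integrableD => //; exact: integrableZl.
Qed.

Lemma Rintegral_lin D f g a b : measurable D ->
  mu.-integrable D (EFin \o f) -> mu.-integrable D (EFin \o g) ->
  \int[mu]_(x in D) (a * f x + b * g x) =
  a * \int[mu]_(x in D) f x + b * \int[mu]_(x in D) g x.
Proof.
move=> mD fi gi.
have ai h c : mu.-integrable D (EFin \o h) ->
    mu.-integrable D (EFin \o (fun x => c * h x)).
  move=> hi; suff : mu.-integrable D (fun x => c%:E * (h x)%:E)%E by [].
  exact: integrableZl.
by rewrite RintegralD//; [rewrite !RintegralZl|exact: ai|exact: ai].
Qed.

Lemma le_integrableR D f g : measurable D -> measurable_fun D f ->
  (forall x, D x -> `|f x| <= g x) ->
  mu.-integrable D (EFin \o g) -> mu.-integrable D (EFin \o f).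
Proof.
move=> mD mf fg; apply: le_integrable => //; first by apply/measurable_EFinP.
by move=> x Dx /=; rewrite lee_fin (le_trans (fg x Dx))// ler_norm.
Qed.

Lemma Rintegral_gt0 D f x : open D -> mu.-integrable D (EFin \o f) ->
  (forall y, D y -> 0 <= f y) -> D x -> 0 < f x -> {for x, continuous f} ->
  0 < \int[mu]_(y in D) f y.
Proof.
move=> oD fi f0 Dx fx cf.
have mD : measurable D by exact: open_measurable.
have : \forall y \near x, D y /\ f x / 2 <= f y.
  near=> y; split; first by near: y; exact: open_nbhs_nbhs.
  rewrite ltW//; near: y; apply: (cvgr_gt (f x) cf).
  by rewrite ltr_pdivrMr// ltr_pMr// ltr1n.
move=> /nbhs_ballP[e /= e0 xe].
(* On this interval of length e/2 inside [D] the integrand is at least f(x)/2, giving the explicit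
   lower bound (f(x)/2)(e/2). *)
have sub y : x <= y <= x + e / 2 -> D y /\ f x / 2 <= f y.
  move=> /andP[xy ye]; apply: xe; rewrite /ball/= distrC ger0_norm ?subr_ge0//.
  by rewrite ltrBlDl (le_lt_trans ye)// ltrD2l ltr_pdivrMr// ltr_pMr// ltr1n.
pose I : set R := `[x, x + e / 2]%classic.
have mI : measurable I by exact: measurable_itv.
have subI : I `<=` D by move=> y; rewrite /I/= in_itv/= => /sub[].
have mf : measurable_fun D f by apply/measurable_EFinP; exact: measurable_int fi.
have Ifin : mu I = (e / 2)%:E.
  rewrite /I lebesgue_measure_itv/= lte_fin ltrDl divr_gt0//.
  by rewrite -EFinB addrAC subrr add0r.
apply: (@lt_le_trans _ _ (f x / 2 * (e / 2))); first by rewrite mulr_gt0 ?divr_gt0.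
rewrite -lee_fin /Rintegral fineK; last exact: integrable_fin_num.
have -> : (f x / 2 * (e / 2))%:E = (\int[mu]_(y in I) (f x / 2)%:E)%E.
  by rewrite integral_cst // EFinM -Ifin.
apply: (@le_trans _ _ (\int[mu]_(y in I) (f y)%:E)%E).
  apply: ge0_le_integral => //=.
  - by move=> y _; rewrite lee_fin divr_ge0 ?ltW.
  - by apply/measurable_EFinP; exact: measurable_funS mf.
  - by move=> y; rewrite /I/= in_itv/= => /sub[_]; rewrite lee_fin.
apply: ge0_subset_integral => //=; first by apply/measurable_EFinP.
Unshelve. all: by end_near. Qed.

End RintegralLemmas.

(** * Gamma and Beta functions *)

Section PowR.
Context {R : realType}.
Notation mu := (@lebesgue_measure R).
Implicit Types (a b s t u x z : R).

Lemma powRD_gt0 x r s : 0 < x -> x `^ (r + s) = x `^ r * x `^ s.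
Proof. by move=> x0; rewrite powRD// (gt_eqF x0) implybT. Qed.

Lemma ler_powRl r x y : 0 <= r -> 0 <= x -> x <= y -> x `^ r <= y `^ r.
Proof.
move=> r0 x0 xy; apply: (ge0_ler_powR r0) => //; rewrite nnegrE//.
exact: le_trans xy.
Qed.

(** The tangent of the concave function u^s at u = 1, obtained from Young's inequality with
    exponents 1/s and 1/(1-s). *)
Lemma powR_le_affine u s : 0 <= u -> 0 <= s <= 1 -> u `^ s <= (1 - s) + s * u.
Proof.
move=> u0 /andP[]; rewrite le_eqVlt => /predU1P[<- _|s0].
  by rewrite powRr0 subr0 mul0r addr0.
rewrite le_eqVlt => /predU1P[->|s1]; first by rewrite powRr1// subrr add0r mul1r.
have := @conjugate_powR R (u `^ s) 1 s^-1 (1 - s)^-1 (powR_ge0 _ _) ler01.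
rewrite !invr_gt0 subr_gt0 !invrK => /(_ s0 s1).
rewrite [s + _]addrC subrK powR1 mulr1 mul1r -powRrM divff ?gt_eqF// powRr1//.
by move=> /(_ erefl); rewrite addrC [u * s]mulrC.
Qed.

End PowR.

Section GammaBeta.
Context {R : realType}.
Notation mu := (@lebesgue_measure R).
Implicit Types (a b s t u x z : R).

(** This is t/q <= 1 + t/q <= e^(t/q) raised to the power q. *)
Lemma powR_expR_le q t : 0 < q -> 0 <= t -> t `^ q * expR (- t) <= q `^ q.
Proof.
move=> q0 t0.
have h : (t / q) `^ q <= expR t.
  have -> : expR t = expR (t / q) `^ q by rewrite -expRM divfK// gt_eqF.
  rewrite ler_powRl ?divr_ge0 ?(ltW q0)//.
  by rewrite (le_trans _ (expR_ge1Dx _))// lerDr.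
have -> : t `^ q = (t / q) `^ q * q `^ q.
  by rewrite -powRM ?divr_ge0 ?(ltW q0)// divfK// gt_eqF.
rewrite mulrAC expRN -[leRHS]mul1r ler_wpM2r ?powR_ge0//.
by rewrite ler_pdivrMr ?expR_gt0// mul1r.
Qed.

Lemma powR_cvgy z : 0 < z -> x `^ z @[x --> +oo] --> (+oo : set_system R).
Proof.
move=> z0; apply/cvgryPge => A; near=> x.
pose B := Num.max A 1.
have B0 : 0 <= B by rewrite le_max ler01 orbT.
apply: (@le_trans _ _ B); first by rewrite le_max lexx.
rewrite -[leLHS](powRr1 B0) -(mulVf (lt0r_neq0 z0)) powRrM.
have Bx : B `^ z^-1 <= x by near: x; apply: nbhs_pinfty_ge; exact: num_real.
have B'0 : 0 <= B `^ z^-1 by exact: powR_ge0.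
exact: ler_powRl (ltW z0) B'0 Bx.
Unshelve. all: by end_near. Qed.

Lemma powR_expR_cvg0 z : 0 < z -> x `^ z * expR (- x) @[x --> +oo] --> (0 : R).
Proof.
move=> z0; pose C := (z + 1) `^ (z + 1).
apply: (@squeeze_cvgr _ _ _ _ (cst 0) (fun x => C * x^-1)).
- near=> x; have x0 : 0 < x by near: x; apply: nbhs_pinfty_gt; exact: num_real.
  rewrite mulr_ge0 ?powR_ge0 ?expR_ge0//= ler_pdivlMr//.
  rewrite mulrAC -[X in _ * X * _](powRr1 (ltW x0)) -powRD_gt0//.
  by rewrite powR_expR_le ?addr_gt0// ltW.
- exact: cvg_cst.
- rewrite -[X in _ --> X](mulr0 C); apply: cvgM; first exact: cvg_cst.
  by apply/gtr0_cvgV0; [apply: nbhs_pinfty_gt; exact: num_real|exact: cvg_id].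
Unshelve. all: by end_near. Qed.

Lemma continuous_powR z x : 0 < x -> {for x, continuous (@powR R ^~ z)}.
Proof.
move=> x0; apply/differentiable_continuous/derivable1_diffP.
by have [] := is_derive1_powR z x0.
Qed.

Definition gamma_ker z t := t `^ (z - 1) * expR (- t).

Lemma GammaE z : Gamma z = \int[mu]_(t in `]0%R, +oo[) gamma_ker z t.
Proof. by []. Qed.

Lemma continuous_gamma_ker z x : 0 < x -> {for x, continuous (gamma_ker z)}.
Proof.
move=> x0; apply: continuousM; first exact: continuous_powR.
by apply: continuous_comp; [exact: opp_continuous|exact: continuous_expR].
Qed.

Lemma measurable_gamma_ker z : measurable_fun setT (gamma_ker z).
Proof.
apply: measurable_funM; first exact: measurable_powR.
by apply: measurableT_comp => //; exact: measurable_expR.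
Qed.

Let onepowR_gt0 z x : 0 < 1 + x `^ z.
Proof. by rewrite (lt_le_trans ltr01)// lerDl powR_ge0. Qed.

(** The comparison function [f] is the derivative of -1/(1 + x^z), a bounded antiderivative which
    handles 0 and infinity together. The constant comes from (1 + t^z)^2 <= 2 + 2 t^(2z) and t^(2z)
    e^(-t) <= K. *)
Lemma integrable_gamma_ker z : 0 < z ->
  mu.-integrable `]0%R, +oo[ (EFin \o gamma_ker z).
Proof.
move=> z0; pose K := (2 * z) `^ (2 * z).
pose f x := z * x `^ (z - 1) / (1 + x `^ z) ^+ 2.
have fi : mu.-integrable `]0%R, +oo[ (EFin \o f).
  apply: (@FTC0y_ge0_integrable R (fun x => - (1 + x `^ z)^-1) f (- 1) (- 0)).
  - move=> x x0; have h := is_derive1_powR z x0.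
    have h1 : is_derive x 1 (fun y => 1 + y `^ z) (0 + z * x `^ (z - 1)).
      exact: is_deriveD.
    have := is_deriveN (@is_deriveV R (fun y => 1 + y `^ z) x _ 1
      (lt0r_neq0 (onepowR_gt0 z x)) h1).
    move=> /is_derive_eq; apply; rewrite /f /GRing.scale/=; field.
    by rewrite gt_eqF.
  - move=> x x0; apply: continuousM.
      by apply: continuousM; [exact: cst_continuous|exact: continuous_powR].
    apply: continuousV; first by rewrite expf_neq0// gt_eqF.
    have h : {for x, continuous (fun y => 1 + y `^ z)}.
      by apply: continuousD; [exact: cst_continuous|exact: continuous_powR].
    exact: (continuousM h h).
  - apply: cvgN; rewrite -[X in _ --> X]invr1; apply: cvgV => //.
    by rewrite -[X in _ --> X]addr0; apply: cvgD; [exact: cvg_cst|exact: powR_cvg0].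
  - apply: cvgN; apply/gtr0_cvgV0; first by near=> x; exact: onepowR_gt0.
    have := powR_cvgy z0; rewrite !cvgryPge => h A.
    by apply: filterS (h A) => x /le_trans; apply; rewrite lerDr.
  - move=> x x0; rewrite /f divr_ge0 ?sqr_ge0 ?mulr_ge0 ?powR_ge0//.
    exact: ltW.
have := integrable_lin ((2 + 2 * K) / z) 0 (measurable_itv _) fi fi.
move=> Cfi; apply: (le_integrableR _ _ _ Cfi) => //.
  by apply: measurable_funTS; exact: measurable_gamma_ker.
move=> t; rewrite /= in_itv/= andbT => t0; rewrite mul0r addr0.
rewrite ger0_norm ?mulr_ge0 ?powR_ge0 ?expR_ge0// /f /gamma_ker.
rewrite [leRHS](_ : _ = t `^ (z - 1) * ((2 + 2 * K) / (1 + t `^ z) ^+ 2)); last first.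
  by field; rewrite !gt_eqF.
rewrite ler_wpM2l ?powR_ge0// ler_pdivlMr ?exprn_gt0// mulrC.
have tK := @powR_expR_le (2 * z) t (mulr_gt0 (ltr0n _ 2) z0) (ltW t0).
have e1 : expR (- t) <= 1 by rewrite -expR0 ler_expR oppr_le0 ltW.
have tE : t `^ (2 * z) = t `^ z * t `^ z by rewrite -powRD_gt0//; congr powR; ring.
rewrite (@le_trans _ _ (2 * expR (- t) + 2 * (t `^ (2 * z) * expR (- t))))//.
  rewrite mulrA -mulrDl ler_wpM2r ?expR_ge0// tE.
  by have := sqr_ge0 (1 - t `^ z); rewrite !expr2; lra.
by move: tK e1; rewrite -/K; lra.
Unshelve. all: by end_near. Qed.

(** Integration by parts, as the integral of the derivative of t^z e^(-t), which vanishes at both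
    ends. *)
Lemma GammaS z : 0 < z -> Gamma (z + 1) = z * Gamma z.
Proof.
move=> z0; have z10 : 0 < z + 1 by rewrite addr_gt0.
have iz := integrable_gamma_ker z0; have iz1 := integrable_gamma_ker z10.
apply/eqP; rewrite eq_sym -subr_eq0 -[X in _ - X]mul1r -mulNr !GammaE.
rewrite -Rintegral_lin//; apply/eqP; rewrite -[RHS](subrr 0).
apply: (@FTC0y R (fun x => x `^ z * expR (- x))).
- move=> x x0; have h := is_derive1_powR z x0.
  have h1 : is_derive x 1 (fun y => expR (- y)) (expR (- x) * (- 1)).
    exact: is_derive1_comp.
  have := is_deriveM h h1.
  by move=> /is_derive_eq; apply; rewrite /gamma_ker addrK /GRing.scale/=; ring.
- move=> x x0; apply: continuousD; (apply: continuousM; first exact: cst_continuous);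
    exact: continuous_gamma_ker.
- rewrite -[X in _ --> X](mul0r (expR (- 0))); apply: cvgM; first exact: powR_cvg0.
  apply: cvg_at_right_filter.
  by apply: continuous_comp; [exact: opp_continuous|exact: continuous_expR].
- exact: powR_expR_cvg0.
- exact: integrable_lin.
Qed.

Lemma Gamma_gt0 z : 0 < z -> 0 < Gamma z.
Proof.
move=> z0; apply: (@Rintegral_gt0 R _ _ 1) => //.
- exact: integrable_gamma_ker.
- by move=> y _; rewrite mulr_ge0 ?powR_ge0 ?expR_ge0.
- by rewrite /= in_itv/= ltr01.
- exact: continuous_gamma_ker.
Qed.

Lemma Gamma1 : Gamma (1 : R) = 1.
Proof.
rewrite GammaE; transitivity (0 - (- 1) : R); last by rewrite sub0r opprK.
apply: (@FTC0y R (fun x => - expR (- x))).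
- move=> x x0.
  have h1 : is_derive x 1 (fun y => expR (- y)) (expR (- x) * (- 1)).
    exact: is_derive1_comp.
  have := is_deriveN h1; move=> /is_derive_eq; apply.
  by rewrite /gamma_ker subrr powRr0; ring.
- by move=> x x0; exact: continuous_gamma_ker.
- apply: cvgN; rewrite -[X in _ --> X]expR0 -[X in expR X]oppr0.
  apply: cvg_at_right_filter.
  by apply: continuous_comp; [exact: opp_continuous|exact: continuous_expR].
- by rewrite -[X in _ --> X]oppr0; apply: cvgN; exact: cvgr_expR.
- exact: integrable_gamma_ker.
Qed.

End GammaBeta.

(** * Beta integrals *)

Section BetaFunction.
Context {R : realType}.
Notation mu := (@lebesgue_measure R).
Implicit Types (a b s t u x z : R).

Definition beta_ker a b x := x `^ (a - 1) * (1 - x) `^ (b - 1).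
Definition Beta a b := \int[mu]_(x in `]0, 1[) beta_ker a b x.

Lemma is_derive_powR1B b x : x < 1 ->
  is_derive x 1 (fun y : R => (1 - y) `^ b) (- (b * (1 - x) `^ (b - 1))).
Proof.
move=> x1; have x0 : 0 < 1 - x by rewrite subr_gt0.
have h1 : is_derive x 1 (fun y : R => 1 - y) (0 - 1) by exact: is_deriveB.
have := @is_derive1_comp R (@powR R ^~ b) (fun y : R => 1 - y) x _ _ (is_derive1_powR b x0) h1.
by move=> /is_derive_eq; apply; ring.
Qed.

Lemma continuous_powR1B b x : x < 1 -> {for x, continuous (fun y : R => (1 - y) `^ b)}.
Proof.
move=> x1; apply/differentiable_continuous/derivable1_diffP.
by have [] := is_derive_powR1B b x1.
Qed.

Lemma powR1B_cvg0 b : 0 < b -> (1 - x) `^ b @[x --> (1 : R)^'-] --> (0 : R).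
Proof.
move=> b0; apply/cvg_at_leftP => u [u1 ul].
move/cvg_at_rightP : (powR_cvg0 b0); apply; split=> [n|].
  by rewrite subr_gt0.
by rewrite -[X in _ --> X](subrr 1); apply: cvgB => //; exact: cvg_cst.
Qed.

Lemma continuous_beta_ker a b x : 0 < x < 1 -> {for x, continuous (beta_ker a b)}.
Proof.
by move=> /andP[x0 x1]; apply: continuousM; [exact: continuous_powR|
  exact: continuous_powR1B].
Qed.

Lemma measurable_beta_ker a b : measurable_fun setT (beta_ker a b).
Proof.
apply: measurable_funM; first exact: measurable_powR.
apply: (@measurableT_comp _ _ _ _ _ _ (@powR R ^~ (b - 1))).
  exact: measurable_powR.
by apply: measurable_funB.
Qed.

Lemma beta_ker_ge0 a b x : 0 <= beta_ker a b x.
Proof. by rewrite mulr_ge0 ?powR_ge0. Qed.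

(* 1 / (x (1 - x)) = 1 / x + 1 / (1 - x) reduces the two-sided singularity to
   one-sided ones. *)
Let beta_ker_le a b x : 0 < a -> 0 < b -> 0 < x < 1 ->
  beta_ker a b x <= 1 * x `^ (a - 1) + 1 * (1 - x) `^ (b - 1).
Proof.
move=> a0 b0 /andP[x0 x1]; have y0 : 0 < 1 - x by rewrite subr_gt0.
have le1 (c y : R) : 0 < c -> 0 < y < 1 -> y * y `^ (c - 1) <= 1.
  move=> c0 /andP[u0 u1]; rewrite mulr_powRB1 ?(ltW u0)//.
  by have := ler_powRl (ltW c0) (ltW u0) (ltW u1); rewrite powR1.
have hx : x * x `^ (a - 1) <= 1 by rewrite le1 ?x0.
have hy : (1 - x) * (1 - x) `^ (b - 1) <= 1.
  by rewrite le1 ?y0//= ltrBlDr ltrDl.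
rewrite /beta_ker !mul1r; set X := _ `^ (a - 1) in hx *; set Y := _ `^ _ in hy *.
have X0 : 0 <= X by exact: powR_ge0.
have Y0 : 0 <= Y by exact: powR_ge0.
rewrite (_ : X * Y = X * ((1 - x) * Y) + Y * (x * X)); last by ring.
by rewrite lerD// ler_piMr.
Qed.

Lemma integrable_beta_ker a b : 0 < a -> 0 < b ->
  mu.-integrable `]0, 1[ (EFin \o beta_ker a b).
Proof.
move=> a0 b0.
have i1 : mu.-integrable `]0, 1[ (EFin \o (fun x => x `^ (a - 1))).
  apply: (@FTC01_ge0_integrable R (fun x => a^-1 * x `^ a) _ (a^-1 * 0) (a^-1 * 1 `^ a)).
  - move=> x /andP[x0 x1]; have := is_deriveZ a^-1 (is_derive1_powR a x0).
    by move=> /is_derive_eq; apply; rewrite /GRing.scale/= mulKf ?gt_eqF.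
  - by move=> x /andP[x0 x1]; exact: continuous_powR.
  - by apply: cvgM; [exact: cvg_cst|exact: powR_cvg0].
  - apply: cvgM; first exact: cvg_cst.
    by apply: cvg_at_left_filter; exact: continuous_powR.
  - by move=> x _; exact: powR_ge0.
have i2 : mu.-integrable `]0, 1[ (EFin \o (fun x => (1 - x) `^ (b - 1))).
  apply: (@FTC01_ge0_integrable R (fun x => - b^-1 * (1 - x) `^ b) _
    (- b^-1 * (1 - 0) `^ b) (- b^-1 * 0)).
  - move=> x /andP[x0 x1]; have := is_deriveZ (- b^-1) (is_derive_powR1B b x1).
    by move=> /is_derive_eq; apply; rewrite /GRing.scale/= mulrNN mulKf ?gt_eqF.
  - by move=> x /andP[x0 x1]; exact: continuous_powR1B.
  - apply: cvgM; first exact: cvg_cst.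
    by apply: cvg_at_right_filter; exact: continuous_powR1B.
  - by apply: cvgM; [exact: cvg_cst|exact: powR1B_cvg0].
  - by move=> x _; exact: powR_ge0.
apply: (le_integrableR _ _ _ (integrable_lin 1 1 _ i1 i2)) => //.
  by apply: measurable_funTS; exact: measurable_beta_ker.
move=> x; rewrite /= in_itv/= => x01.
by rewrite ger0_norm ?beta_ker_ge0// beta_ker_le.
Qed.

Lemma Beta_gt0 a b : 0 < a -> 0 < b -> 0 < Beta a b.
Proof.
move=> a0 b0; have h : 0 < (2^-1 : R) < 1 by rewrite invr_gt0 ltr0n invf_lt1 ?ltr1n.
apply: (@Rintegral_gt0 R _ _ 2^-1) => //.
- exact: integrable_beta_ker.
- by move=> y _; exact: beta_ker_ge0.
- by rewrite /beta_ker mulr_gt0 ?powR_gt0 ?subr_gt0; case/andP: h.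
- exact: continuous_beta_ker.
Qed.

(** The function x^a (1-x)^b vanishes at both ends, and its derivative is a times one kernel minus a
    + b times the other. *)
Lemma BetaS a b : 0 < a -> 0 < b -> (a + b) * Beta (a + 1) b = a * Beta a b.
Proof.
move=> a0 b0; have a10 : 0 < a + 1 by rewrite addr_gt0.
have ia := integrable_beta_ker a0 b0; have ia1 := integrable_beta_ker a10 b0.
apply/esym/eqP; rewrite -subr_eq0 -mulNr /Beta -Rintegral_lin//; apply/eqP.
rewrite -[RHS](subrr 0).
apply: (@FTC01 R (fun x => x `^ a * (1 - x) `^ b)).
- move=> x /andP[x0 x1]; have y0 : 0 < 1 - x by rewrite subr_gt0.
  have := is_deriveM (is_derive1_powR a x0) (is_derive_powR1B b x1).
  move=> /is_derive_eq; apply; rewrite /beta_ker addrK /GRing.scale/=.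
  rewrite -(mulr_powRB1 (ltW x0) a0) -(mulr_powRB1 (ltW y0) b0); ring.
- move=> x x01; apply: continuousD; (apply: continuousM; first exact: cst_continuous);
    exact: continuous_beta_ker.
- rewrite -[X in _ --> X](mul0r ((1 - 0) `^ b)); apply: cvgM; first exact: powR_cvg0.
  by apply: cvg_at_right_filter; exact: continuous_powR1B.
- rewrite -[X in _ --> X](mulr0 (1 `^ a)); apply: cvgM; last exact: powR1B_cvg0.
  by apply: cvg_at_left_filter; exact: continuous_powR.
- exact: integrable_lin.
Qed.

Lemma Beta1 b : 0 < b -> Beta 1 b = b^-1.
Proof.
move=> b0.
transitivity (- b^-1 * 0 - (- b^-1 * (1 - 0) `^ b)).
  apply: (@FTC01 R (fun x => - b^-1 * (1 - x) `^ b)).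
  - move=> x /andP[x0 x1]; have := is_deriveZ (- b^-1) (is_derive_powR1B b x1).
    move=> /is_derive_eq; apply.
    by rewrite /GRing.scale/= mulrNN mulKf ?gt_eqF// /beta_ker subrr powRr0 mul1r.
  - by move=> x x01; exact: continuous_beta_ker.
  - apply: cvgM; first exact: cvg_cst.
    by apply: cvg_at_right_filter; exact: continuous_powR1B.
  - by apply: cvgM; [exact: cvg_cst|exact: powR1B_cvg0].
  - exact: integrable_beta_ker.
by rewrite subr0 powR1 mulr0 mulr1 sub0r opprK.
Qed.

(* An antiderivative of 1 / sqrt (x (1 - x)) is 2 atan (sqrt (x / (1 - x))). *)
Lemma Beta_half : Beta 2^-1 2^-1 = pi.
Proof.
pose h : R := 2^-1; have h0 : 0 < h by rewrite invr_gt0.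
have hN : h - 1 = - h by rewrite /h; field.
pose u (x : R) := x `^ h * (1 - x) `^ (- h).
have u_gt0 x : 0 < x < 1 -> 0 < u x.
  by move=> /andP[x0 x1]; rewrite mulr_gt0 ?powR_gt0 ?subr_gt0.
transitivity (2 * (pi / 2) - 2 * atan (0 : R)); last by rewrite atan0; field.
apply: (@FTC01 R (fun x => 2 * atan (u x))).
- move=> x /andP[x0 x1]; have y0 : 0 < 1 - x by rewrite subr_gt0.
  have h1 : is_derive x 1 u (x `^ h * - (- h * (1 - x) `^ (- h - 1))
      + (1 - x) `^ (- h) * (h * x `^ (h - 1))).
    exact: is_deriveM (is_derive1_powR h x0) (is_derive_powR1B (- h) x1).
  have := is_deriveZ 2 (@is_derive1_comp R (@atan R) u x _ _ (is_derive1_atan (u x)) h1).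
  move=> /is_derive_eq; apply; rewrite /GRing.scale/=.
  rewrite /u /beta_ker -/h hN !powRD_gt0// !powRN !powRr1 ?(ltW x0) ?(ltW y0)//.
  have sq (y : R) : 0 < y -> y `^ h ^+ 2 = y.
    move=> y1; rewrite -powR_mulrn ?powR_ge0// -powRrM.
    by rewrite (_ : h * 2%:R = 1) ?powRr1 ?(ltW y1)// /h; field.
  have := sq x x0; have := sq _ y0; rewrite -/h.
  have := powR_gt0 h x0; have := powR_gt0 h y0.
  set p := x `^ h; set q := (1 - x) `^ h => q0 p0 qE pE.
  have D : p ^+ 2 + q ^+ 2 = 1 by rewrite qE pE addrC subrK.
  have np := gt_eqF p0; have nq := gt_eqF q0.
  have -> : (1 + (p / q) ^+ 2)^-1 = q ^+ 2.
    rewrite (_ : 1 + (p / q) ^+ 2 = (p ^+ 2 + q ^+ 2) / q ^+ 2).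
      by rewrite D mul1r invrK.
    by field; rewrite nq.
  rewrite -qE; transitivity ((p ^+ 2 + q ^+ 2) / (p * q)); last first.
    by rewrite D mul1r invfM.
  by rewrite /h; field; rewrite np nq.
- by move=> x x01; exact: continuous_beta_ker.
- have u0 : u x @[x --> 0^'+] --> (0 : R).
    rewrite -[X in _ --> X](mul0r ((1 - 0) `^ (- h))).
    apply: cvgM; first exact: powR_cvg0.
    by apply: cvg_at_right_filter; exact: continuous_powR1B.
  apply: cvgM; first exact: cvg_cst.
  exact: (cvg_comp _ _ u0 (@continuous_atan R 0)).
- have uy : u x @[x --> (1 : R)^'-] --> +oo.
    apply/gtr0_cvgV0.
      by near=> x; apply: u_gt0; apply/andP; split; near: x;
        [exact: nbhs_left_gt|exact: nbhs_left_lt].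
    rewrite (_ : unstable.inv_fun _ = fun x => x `^ (- h) * (1 - x) `^ h); last first.
      by apply/funext => x; rewrite /unstable.inv_fun /u invfM -!powRN opprK.
    rewrite -[X in _ --> X](mulr0 (1 `^ (- h))); apply: cvgM; last exact: powR1B_cvg0.
    by apply: cvg_at_left_filter; exact: continuous_powR.
  apply: cvgM; first exact: cvg_cst.
  exact: (cvg_comp _ _ uy (@cvgy_atan R)).
- exact: integrable_beta_ker.
Unshelve. all: by end_near. Qed.

Lemma pos_real_ind (P : R -> Prop) :
  (forall s, 0 < s <= 1 -> P s) -> (forall a, 0 < a -> P a -> P (a + 1)) ->
  forall a, 0 < a -> P a.
Proof.
move=> P01 PS a a0.
have : forall n : nat, forall b, 0 < b <= n.+1%:R -> P b.
  elim=> [|n IH] b; first exact: P01.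
  move=> /andP[b0 bn]; have [b1|b1] := leP b 1; first by apply: P01; rewrite b0.
  rewrite -[b](subrK 1); apply: PS; first by rewrite subr_gt0.
  by apply: IH; rewrite subr_gt0 b1/= lerBlDr natr1.
by move=> /(_ (Num.trunc a)); apply; rewrite a0 ltW// truncnS_gt.
Qed.

End BetaFunction.

(** * Growth of Gamma along the integers and Euler's Beta formula *)

Section GammaAsymptotics.
Context {R : realType}.
Notation mu := (@lebesgue_measure R).
Implicit Types (a b s t x z : R).

(* Integrating the affine upper bound of the concave function t^s at t = z. *)
Lemma Gamma_le_powR z s : 0 < z -> 0 <= s <= 1 -> Gamma (z + s) <= z `^ s * Gamma z.
Proof.
move=> z0 s01; have /andP[s0 s1] := s01.
have iz := integrable_gamma_ker z0.
have iz1 : mu.-integrable `]0%R, +oo[ (EFin \o gamma_ker (z + 1)).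
  by apply: integrable_gamma_ker; rewrite addr_gt0.
have izs : mu.-integrable `]0%R, +oo[ (EFin \o gamma_ker (z + s)).
  by apply: integrable_gamma_ker; rewrite ltr_pwDl.
have -> : z `^ s * Gamma z =
    (z `^ s * (1 - s)) * Gamma z + (z `^ s * (s / z)) * Gamma (z + 1).
  by rewrite GammaS//; field; rewrite gt_eqF.
rewrite !GammaE -Rintegral_lin//; apply: le_Rintegral => //; first exact: integrable_lin.
move=> t; rewrite /= in_itv/= andbT => t0; rewrite /gamma_ker.
have -> : t `^ (z + s - 1) = t `^ (z - 1) * t `^ s by rewrite -powRD_gt0// addrAC.
have -> : t `^ (z + 1 - 1) = t `^ (z - 1) * t.
  by rewrite -[X in _ * X](powRr1 (ltW t0)) -powRD_gt0// addrAC.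
have -> : t `^ s = z `^ s * (t / z) `^ s.
  by rewrite -powRM ?(ltW z0) ?(ltW (divr_gt0 t0 z0))// mulrC divfK// gt_eqF.
have := @powR_le_affine R (t / z) s (ltW (divr_gt0 t0 z0)) s01.
move=> /(ler_wpM2l (mulr_ge0 (mulr_ge0 (powR_ge0 t (z - 1)) (expR_ge0 (- t)))
  (powR_ge0 z s))).
move: (t `^ (z - 1)) (z `^ s) ((t / z) `^ s) (expR (- t)) => A B C E h.
rewrite (_ : A * (B * C) * E = A * E * B * C); last by ring.
by rewrite (le_trans h)// le_eqVlt; apply/orP; left; apply/eqP; ring.
Qed.

Lemma cvg_addr_div x : (n.+1%:R + x) / n.+1%:R @[n --> \oo] --> (1 : R).
Proof.
rewrite (_ : (fun n => _) = fun n => 1 + x * harmonic n); last first.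
  by apply/funext => n; rewrite /harmonic /=; field.
rewrite -[X in _ --> X]addr0 -[X in _ + X](mulr0 x); apply: cvgD; first exact: cvg_cst.
by apply: cvgM; [exact: cvg_cst|exact: cvg_harmonic].
Qed.

(** For 0 < x <= 1, [Gamma_le_powR] at N gives the upper bound 1; applied at N + x with exponent 1 -
    x it gives the lower bound N/(N+1). Raising x by 1 multiplies the ratio by (N + x)/N. *)
Lemma Gamma_ratio_cvg x : 0 < x ->
  Gamma (n.+1%:R + x) / (Gamma n.+1%:R * n.+1%:R `^ x) @[n --> \oo] --> (1 : R).
Proof.
have G0 n : 0 < Gamma (n.+1%:R : R) by apply: Gamma_gt0.
move: x; apply: pos_real_ind => [s /andP[s0 s1]|x x0 IH]; last first.
  rewrite (_ : (fun n => _) = fun n => (n.+1%:R + x) / n.+1%:R *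
      (Gamma (n.+1%:R + x) / (Gamma n.+1%:R * n.+1%:R `^ x))); last first.
    apply/funext => n; have N0 : 0 < (n.+1%:R : R) by [].
    rewrite addrA GammaS ?addr_gt0// powRD_gt0// powRr1//.
    have := gt_eqF (powR_gt0 x N0); have := gt_eqF (G0 n).
    move: (Gamma n.+1%:R) (Gamma (n.+1%:R + x)) (_ `^ x) => G H p Gn0 p0.
    by field; rewrite p0 Gn0 gt_eqF.
  by rewrite -[X in _ --> X]mulr1; apply: cvgM; [exact: cvg_addr_div|exact: IH].
apply: (@squeeze_cvgr _ _ _ _ (fun n => ((n.+1%:R + 1) / n.+1%:R)^-1) (cst 1)).
- apply: nearW => n; have N0 : 0 < (n.+1%:R : R) by [].
  set N : R := n.+1%:R in N0 *.
  have D0 : 0 < Gamma N * N `^ s by rewrite mulr_gt0 ?powR_gt0 ?Gamma_gt0.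
  have Ns0 : 0 < N + s by rewrite addr_gt0.
  apply/andP; split; last first.
    by rewrite ler_pdivrMr// mul1r mulrC Gamma_le_powR// ltW.
  have := @Gamma_le_powR (N + s) (1 - s) Ns0.
  rewrite subr_ge0 s1 lerBlDr lerDl (ltW s0) -addrA [s + _]addrC subrK => /(_ isT).
  rewrite GammaS// => h.
  rewrite invf_div ler_pdivlMr// mulrAC ler_pdivrMr ?addr_gt0//.
  have Nsh : N `^ s * (N + s) `^ (1 - s) <= N + 1.
    apply: (@le_trans _ _ ((N + s) `^ s * (N + s) `^ (1 - s))).
      by rewrite ler_wpM2r ?powR_ge0// ler_powRl ?lerDl ?(ltW s0) ?(ltW N0).
    by rewrite -powRD_gt0// [s + _]addrC subrK powRr1 ?(ltW Ns0)// lerD2l.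
  have := ler_wpM2l (powR_ge0 N s) h.
  have := ler_wpM2r (ltW (Gamma_gt0 Ns0)) Nsh.
  by move: (N `^ s) ((N + s) `^ (1 - s)) (Gamma N) (Gamma (N + s)) => A B C D; lra.
- by rewrite -[X in _ --> X]invr1; apply: cvgV => //; exact: cvg_addr_div.
- exact: cvg_cst.
Qed.

Let Beta_monotone a c b : 0 < a -> a <= c -> 0 < b -> Beta c b <= Beta a b.
Proof.
move=> a0 ac b0; apply: le_Rintegral => //.
- by apply: integrable_beta_ker => //; rewrite (lt_le_trans a0).
- exact: integrable_beta_ker.
move=> x; rewrite /= in_itv/= => /andP[x0 x1]; rewrite ler_wpM2r ?powR_ge0//.
by apply: ger_powR; rewrite ?x0 ?(ltW x1)// lerD2r.
Qed.

(* Both sides satisfy the same recurrence in a, so their ratio is 1-periodic; it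
   tends to 1 along the integers. *)
Lemma BetaE a b : 0 < a -> 0 < b -> Beta a b = Gamma a * Gamma b / Gamma (a + b).
Proof.
move=> a0 b0; move: a a0; pose h a := Beta a b * Gamma (a + b) / Gamma a.
have h_gt0 a : 0 < a -> 0 < h a.
  by move=> a0; rewrite divr_gt0 ?mulr_gt0 ?Beta_gt0 ?Gamma_gt0 ?addr_gt0.
have hS a : 0 < a -> h (a + 1) = h a.
  move=> a0; have ab0 : 0 < a + b by rewrite addr_gt0.
  rewrite /h [a + 1 + b]addrAC !GammaS// mulrA [Beta _ _ * _]mulrC BetaS//.
  have := gt_eqF (Gamma_gt0 a0); move: (Beta a b) (Gamma a) (Gamma (a + b)) => B G H G0.
  by field; rewrite G0 gt_eqF.
have hn a n : 0 < a -> h (n%:R + a) = h a.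
  move=> a0; elim: n => [|n IH]; first by rewrite add0r.
  by rewrite -natr1 addrAC (hS (n%:R + a)) ?IH ?ltr_wpDl.
have h1 : h 1 = Gamma b.
  by rewrite /h Beta1// [1 + b]addrC GammaS// Gamma1; field; rewrite gt_eqF.
suff hE s : 0 < s <= 1 -> h s = Gamma b.
  move=> a a0; have : h a = Gamma b.
    apply: (@pos_real_ind R (fun a => h a = Gamma b)) => [x x01|c c0 hc|//].
      exact: hE.
    by rewrite (hS c c0).
  have := gt_eqF (Gamma_gt0 a0); have := gt_eqF (Gamma_gt0 (addr_gt0 a0 b0)).
  rewrite /h; move: (Beta a b) (Gamma a) (Gamma (a + b)) => B G H H0 G0 <-.
  by field; rewrite H0 G0.
move=> /andP[s0 s1].
pose r x n : R := Gamma (n.+1%:R + x) / (Gamma n.+1%:R * n.+1%:R `^ x).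
pose q n := Beta (n.+1%:R + s) b / Beta n.+1%:R b.
have hq n : h s / h 1 = q n * r (s + b) n / (r b n * r s n).
  have N0 : 0 < (n.+1%:R : R) by [].
  have h1N : h n.+1%:R = h 1 by rewrite -(hn 1 n ltr01) natr1.
  have := hn s n.+1 s0; rewrite -h1N => <-.
  rewrite /q /r /h -[_ + s + b]addrA powRD_gt0//.
  have := gt_eqF (powR_gt0 s N0); have := gt_eqF (powR_gt0 b N0).
  have := gt_eqF (Beta_gt0 N0 b0); have := gt_eqF (Gamma_gt0 N0).
  have := gt_eqF (Gamma_gt0 (addr_gt0 N0 s0)); have := gt_eqF (Gamma_gt0 (addr_gt0 N0 b0)).
  move: (Beta n.+1%:R b) (Beta (n.+1%:R + s) b) (Gamma n.+1%:R) (Gamma (n.+1%:R + s)).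
  move: (Gamma (n.+1%:R + b)) (Gamma (n.+1%:R + (s + b))) (_ `^ s) (_ `^ b).
  move=> Gb Gsb ps pb B0 B1 G Gs e1 e2 e3 e4 e5 e6.
  by field; rewrite e1 e2 e3 e4 e5 e6.
(* As 0 < s <= 1, the numerator lies between Beta(N+1, b) and Beta(N, b), whose ratio is N/(N+b) by
   [BetaS]. *)
have q1 : q n @[n --> \oo] --> (1 : R).
  apply: (@squeeze_cvgr _ _ _ _ (fun n => ((n.+1%:R + b) / n.+1%:R)^-1) (cst 1)).
  - apply: nearW => n; have N0 : 0 < (n.+1%:R : R) by [].
    rewrite /q /=; apply/andP; split; last first.
      by rewrite ler_pdivrMr ?Beta_gt0// mul1r Beta_monotone// lerDl ltW.
    rewrite invf_div ler_pdivlMr ?Beta_gt0// mulrAC ler_pdivrMr ?addr_gt0//.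
    by rewrite -BetaS// mulrC ler_wpM2r ?addr_ge0 ?(ltW b0)// Beta_monotone ?addr_gt0// lerD2l.
  - by rewrite -[X in _ --> X]invr1; apply: cvgV => //; exact: cvg_addr_div.
  - exact: cvg_cst.
have hq1 : q n * r (s + b) n / (r b n * r s n) @[n --> \oo] --> (1 : R).
  rewrite -[X in _ --> X]divr1 -[X in _ / X](mulr1 1).
  apply: cvgM.
    rewrite -[X in _ --> X]mulr1; apply: cvgM; first exact: q1.
    by apply: Gamma_ratio_cvg; rewrite addr_gt0.
  apply: cvgV; first by rewrite mulr1 oner_eq0.
  by apply: cvgM; exact: Gamma_ratio_cvg.
have hcst : h s / h 1 @[n --> \oo] --> (1 : R).
  by apply: cvg_trans hq1; apply: near_eq_cvg; apply: nearW => n; rewrite -hq.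
have e : h s / h 1 = 1 by exact: cvg_unique (cvg_cst _) hcst.
by rewrite -h1; exact: divr1_eq e.
Qed.

Lemma Gamma_half : Gamma (2^-1 : R) ^+ 2 = pi.
Proof.
have h0 : 0 < (2^-1 : R) by rewrite invr_gt0.
rewrite -Beta_half BetaE// (_ : 2^-1 + 2^-1 = 1); last by field.
by rewrite Gamma1 divr1 expr2.
Qed.

End GammaAsymptotics.

(** * The Barnes G-function *)

Section LogRemainder.
Context {R : realType}.
Implicit Types (w x : R) (k N : nat).

(** The derivative of the left-hand function is y^2/(1+y), and 1 + y >= 1/2 produces the constant 2;
    the mean value theorem adds the third power. *)
Lemma ln1D_quadratic_le x : `|x| <= 2^-1 ->
  `|ln (1 + x) - x + x ^+ 2 / 2| <= 2 * `|x| ^+ 3.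
Proof.
move=> x2; pose g y : R := ln (1 + y) - y + y ^+ 2 / 2.
have g0 : g 0 = 0 by rewrite /g addr0 ln1 expr0n/= mul0r subrr addr0.
have pos (y : R) : `|y| <= 2^-1 -> 2^-1 <= 1 + y by move=> /ler_normlP[]; lra.
have dg (y : R) : `|y| <= 2^-1 -> is_derive y 1 g (y ^+ 2 / (1 + y)).
  move=> y2; have y0 : 0 < 1 + y by rewrite (lt_le_trans _ (pos _ y2))// invr_gt0.
  have h1 : is_derive y 1 (fun z : R => 1 + z) (0 + 1) by exact: is_deriveD.
  have h2 := @is_derive1_comp R (@ln R) (fun z : R => 1 + z) y _ _ (is_derive1_ln y0) h1.
  have h3 : is_derive y 1 (fun z : R => z ^+ 2 / 2) y.
    rewrite (_ : (fun z => _) = 2^-1 *: (id ^+ 2)); last first.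
      by apply/funext => z; rewrite !fctE mulrC.
    by apply: is_derive_eq; rewrite /GRing.scale/= expr1 mulr1 mulKf// pnatr_eq0.
  have := is_deriveD (is_deriveB h2 (is_derive_id y 1)) h3.
  by move=> /is_derive_eq; apply; field; rewrite gt_eqF.
have [c c2 gc] : exists2 c, `|c| <= `|x| & g x = c ^+ 2 / (1 + c) * x.
  have cg (a b : R) : `|a| <= 2^-1 -> `|b| <= 2^-1 -> {within `[a, b], continuous g}.
    move=> /ler_normlP[a1 a2] /ler_normlP[b1 b2].
    apply: continuous_in_subspaceT => y; rewrite inE/= in_itv/= => /andP[ay yb].
    apply/differentiable_continuous/derivable1_diffP.
    by have [] := dg y; first by apply/ler_normlP; split; lra.
  have /ler_normlP[x1 x3] := x2.
  have n0 : `|0 : R| <= 2^-1 by rewrite normr0 invr_ge0.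
  have [x0|x0] := leP 0 x.
    have [y|//|c] := @MVT_segment _ g (fun c => c ^+ 2 / (1 + c)) 0 x x0; last 1 first.
      rewrite in_itv/= g0 !subr0 => /andP[c0 cx] ->; exists c => //.
      by rewrite !ger0_norm.
    - rewrite in_itv/= => /andP[y0 yx]; apply: dg; apply/ler_normlP; split; lra.
    - exact: cg.
  have [y|//|c] := @MVT_segment _ g (fun c => c ^+ 2 / (1 + c)) x 0 (ltW x0); last 1 first.
    rewrite in_itv/= g0 !sub0r => /andP[xc c0] h; exists c; last first.
      by apply: oppr_inj; rewrite h mulrN.
    by rewrite !ler0_norm ?lerN2// ltW.
  - rewrite in_itv/= => /andP[y0 yx]; apply: dg; apply/ler_normlP; split; lra.
  - exact: cg.
have c12 := pos c (le_trans c2 x2).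
have c1 : 0 < 1 + c by rewrite (lt_le_trans _ c12)// invr_gt0.
rewrite -/(g x) gc normrM [`|x| ^+ 3]exprSr [leRHS]mulrA ler_wpM2r//.
rewrite normrM normrX normfV (gtr0_norm c1) mulrC ler_pM ?invr_ge0 ?exprn_ge0 ?(ltW c1)//.
  by rewrite -[leRHS]invrK lef_pV2 ?posrE// invr_gt0.
by rewrite lerXn2r// nnegrE.
Qed.

(** The tail is majorized by a telescoping sum, since 1/(n+1)^2 <= 2/(n+1) - 2/(n+2); this is the
    origin of the factor 2. *)
Lemma is_cvg_series_le_sqr (u : R ^nat) (C : R) (K : nat) : 0 <= C ->
  (forall k, (K <= k)%N -> `|u k| <= C / k.+1%:R ^+ 2) -> cvgn (series u).
Proof.
move=> C0 uC; apply: normed_cvg.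
pose S n := \sum_(0 <= k < n) `|u k|; suff : cvgn S by [].
have nd : nondecreasing_seq S.
  by apply/nondecreasing_seqP => n; rewrite /S big_nat_recr//= lerDl.
apply: nondecreasing_is_cvgn => //.
have bound n : (K <= n)%N -> S n <=
    S K + 2 * C / K.+1%:R - 2 * C / n.+1%:R.
  elim: n => [|n IH]; first by rewrite leqn0 => /eqP->; rewrite addrK.
  rewrite leq_eqVlt => /predU1P[<-|Kn]; first by rewrite addrK.
  rewrite /S big_nat_recr//= -/(S n); have {}IH := IH Kn.
  rewrite (le_trans (lerD IH (uC n Kn)))// -addrA lerD2l.
  rewrite -subr_ge0 (_ : _ - _ = C * n%:R / (n.+1%:R ^+ 2 * n.+2%:R)).
    by rewrite divr_ge0// mulr_ge0.
  by rewrite -[n.+2%:R]natr1 -[n.+1%:R]natr1; field; rewrite !natr1 !pnatr_eq0.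
exists (S K + 2 * C / K.+1%:R) => _ [n _ <-].
have [Kn|nK] := leqP K n.
  by rewrite (le_trans (bound n Kn))// gerBl divr_ge0// mulr_ge0.
by rewrite (le_trans (nd _ _ (ltnW nK)))// lerDl divr_ge0// mulr_ge0.
Qed.

End LogRemainder.

(** * Convergence and functional equation of the Weierstrass product *)

Section BarnesProduct.
Context {R : realType}.
Implicit Types (w x z : R) (k n N : nat).

Definition barnes_factor w k : R := (1 + w / k%:R) ^+ k * expR (w ^+ 2 / (2 * k%:R) - w).
Definition barnes_prod w N : R := \prod_(1 <= k < N.+1) barnes_factor w k.
Let H N : R := \sum_(1 <= k < N.+1) k%:R^-1.

(** For w > -1 this is the logarithm of factor k+1. The exponential factor removes the first two
    Taylor terms of the logarithm, so a cubic remainder times k+1 leaves O(1/(k+1)^2). *)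
Let u w k : R := k.+1%:R * ln (1 + w / k.+1%:R) + w ^+ 2 / (2 * k.+1%:R) - w.

Let cvg_u w : cvgn (series (u w)).
Proof.
apply: (@is_cvg_series_le_sqr _ _ (2 * `|w| ^+ 3) (Num.trunc (2 * `|w|))) => [|k wk].
  by rewrite mulr_ge0// exprn_ge0.
have k0 : 0 < (k.+1%:R : R) by [].
have wk2 : `|w / k.+1%:R| <= 2^-1.
  rewrite normrM normfV (gtr0_norm k0) ler_pdivrMr// mulrC ler_pdivlMr// mulrC.
  by rewrite (le_trans (ltW (truncnS_gt _)))// ler_nat ltnS.
have := ln1D_quadratic_le wk2.
set v := ln _; rewrite normrM normfV (gtr0_norm k0) => h.
have -> : u w k = k.+1%:R * (v - w / k.+1%:R + (w / k.+1%:R) ^+ 2 / 2).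
  by rewrite /u -/v; field; rewrite gt_eqF.
rewrite normrM (gtr0_norm k0) (le_trans (ler_wpM2l (ltW k0) h))//.
by rewrite le_eqVlt; apply/orP; left; apply/eqP; field; rewrite gt_eqF.
Qed.

Let powD_gt0 w k : -1 < w -> 0 < 1 + w / k.+1%:R.
Proof.
move=> w1; have k0 : 0 < (k.+1%:R : R) by [].
rewrite (_ : 1 + _ = (k.+1%:R + w) / k.+1%:R); last by field; rewrite gt_eqF.
rewrite divr_gt0// -natr1.
by have : (0 : R) <= k%:R by []; lra.
Qed.

Let barnes_prodE w N : -1 < w -> barnes_prod w N = expR (series (u w) N).
Proof.
move=> w1; rewrite /barnes_prod big_add1 /series/= expR_sum; apply: eq_bigr => k _.
have -> : u w k = k.+1%:R * ln (1 + w / k.+1%:R) + (w ^+ 2 / (2 * k.+1%:R) - w).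
  by rewrite /u addrA.
rewrite expRD; congr (_ * _).
by rewrite expRM_natl lnK ?posrE ?powD_gt0.
Qed.

Lemma barnes_prod_cvg w : -1 < w ->
  exists2 L : R, 0 < L & barnes_prod w N @[N --> \oo] --> L.
Proof.
move=> w1; exists (expR (limn (series (u w)))); first exact: expR_gt0.
under eq_fun do rewrite barnes_prodE//.
by apply: continuous_cvg; [exact: continuous_expR|exact: cvg_u].
Qed.

(** A by-product of convergence: the general term of the series tends to 0. *)
Let ln1D_cvg w : k.+1%:R * ln (1 + w / k.+1%:R) @[k --> \oo] --> w.
Proof.
have := cvg_series_cvg_0 (@cvg_u w) => u0.
have w0 : w ^+ 2 / 2 * harmonic k @[k --> \oo] --> (0 : R).
  by rewrite -[X in _ --> X](mulr0 (w ^+ 2 / 2)); apply: cvgM; [exact: cvg_cst|exact: cvg_harmonic].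
rewrite (_ : (fun k => _) = fun k => u w k - w ^+ 2 / 2 * harmonic k + w); last first.
  apply/funext => k; rewrite /u /harmonic/=.
  by move: (ln _) => l; field.
rewrite -[X in _ --> X]add0r -[X in X + _](subrr 0).
by apply: cvgD; [exact: cvgB|exact: cvg_cst].
Qed.

Let pow_cvg w : -1 < w -> (1 + w / n.+2%:R) ^+ n.+1 @[n --> \oo] --> expR w.
Proof.
move=> w1.
have h1 : expR (k.+1%:R * ln (1 + w / k.+1%:R)) @[k --> \oo] --> expR w.
  by apply: continuous_cvg; [exact: continuous_expR|exact: ln1D_cvg].
have h2 : 1 + w / k.+1%:R @[k --> \oo] --> (1 : R).
  rewrite -[X in _ --> X]addr0 -[X in _ + X](mulr0 w).
  by apply: cvgD; [exact: cvg_cst|apply: cvgM; [exact: cvg_cst|exact: cvg_harmonic]].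
have h3 : (1 + w / k.+1%:R) ^+ k @[k --> \oo] --> expR w.
  rewrite (_ : (fun k => _) = fun k =>
      expR (k.+1%:R * ln (1 + w / k.+1%:R)) / (1 + w / k.+1%:R)); last first.
    apply/funext => k; have h := powD_gt0 k w1.
    by rewrite expRM_natl lnK ?posrE// exprSr mulfK// gt_eqF.
  by rewrite -[X in _ --> X]divr1; apply: cvgM => //; apply: cvgV.
have := h3; rewrite -(cvg_shiftS (fun k => (1 + w / k.+1%:R) ^+ k)); exact.
Qed.

(** The functional equation at finite N, exact and by induction; passing to the limit then only
    needs the behaviour of the explicit right-hand factors. *)
Lemma barnes_prodS w N : -1 < w -> barnes_prod (w + 1) N * Gamma (N%:R + 1 + w) =
  barnes_prod w N *
    (Gamma (1 + w) * (N%:R + 1 + w) ^+ N * expR ((w + 2^-1) * H N - N%:R)).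
Proof.
move=> w1; elim: N => [|N IH].
  rewrite /barnes_prod /H !big_nil !mul1r add0r mulr0 subrr expR0 expr0.
  by rewrite !mulr1.
have prodS v : barnes_prod v N.+1 = barnes_prod v N * barnes_factor v N.+1.
  by rewrite /barnes_prod big_nat_recr.
have HS : H N.+1 = H N + N.+1%:R^-1 by rewrite /H big_nat_recr.
rewrite !prodS HS.
have k0 : 0 < (N.+1%:R : R) by [].
have kw0 : 0 < N%:R + 1 + w by have : (0 : R) <= N%:R by []; lra.
have -> : Gamma (N.+1%:R + 1 + w) = (N%:R + 1 + w) * Gamma (N%:R + 1 + w).
  by rewrite -(GammaS kw0) -natr1; congr Gamma; ring.
have -> : barnes_prod (w + 1) N * barnes_factor (w + 1) N.+1 *
    ((N%:R + 1 + w) * Gamma (N%:R + 1 + w)) =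
  barnes_prod (w + 1) N * Gamma (N%:R + 1 + w) *
    (barnes_factor (w + 1) N.+1 * (N%:R + 1 + w)) by ring.
rewrite IH.
rewrite /barnes_factor -[N.+1%:R]natr1; set k : R := N%:R + 1.
have kN0 : k != 0 by rewrite gt_eqF//; rewrite /k natr1.
have -> : (w + 2^-1) * (H N + k^-1) - k =
    ((w + 2^-1) * H N - N%:R) + ((w + 2^-1) / k - 1) by rewrite /k; ring.
have -> : (w + 1) ^+ 2 / (2 * k) - (w + 1) =
   (w ^+ 2 / (2 * k) - w) + ((w + 2^-1) / k - 1) by field.
rewrite [expR (_ - w + _)]expRD [expR (_ - N%:R + _)]expRD.
have -> : 1 + (w + 1) / k = (k + 1 + w) / k by field.
have -> : 1 + w / k = (k + w) / k by field.
rewrite !expr_div_n [(k + w) ^+ N.+1]exprSr.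
move: (barnes_prod w N) (Gamma (1 + w)) (expR (_ * H N - _)) => A B C.
move: (expR _) (expR _) ((k + w) ^+ N) ((k + 1 + w) ^+ N.+1) => D E F G.
by have := expf_neq0 N.+1 kN0; move: (k ^+ N.+1) => K K0; field.
Qed.

(** [euler_gamma] is defined by [limn], so existence of the limit must be proved: up to 1/(n+1) the
    sequence is a partial sum of 1/k - ln(1 + 1/k) = O(1/k^2). *)
Let euler_gamma_cvg : H n.+1 - ln n.+1%:R @[n --> \oo] --> euler_gamma R.
Proof.
pose v k : R := k.+1%:R^-1 - ln (1 + k.+1%:R^-1).
have cv : cvgn (series v).
  apply: (@is_cvg_series_le_sqr _ _ 2 1) => // k k1.
  have k0 : 0 < (k.+1%:R : R) by [].
  pose x : R := k.+1%:R^-1; have x0 : 0 < x by rewrite invr_gt0.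
  have x2 : x <= 2^-1 by rewrite lef_pV2 ?posrE// ler_nat.
  have := @ln1D_quadratic_le R x; rewrite !(gtr0_norm x0) => /(_ x2).
  rewrite -exprVn /v -/x; move: (ln _) => l.
  have x3 : x ^+ 3 <= 2^-1 * x ^+ 2 by rewrite exprS ler_wpM2r// exprn_ge0// ltW.
  by move=> /ler_normlP[h1 h2]; apply/ler_normlP; split; lra.
have vE n : H n.+1 - ln n.+1%:R = series v n + harmonic n.
  rewrite /harmonic/=; elim: n => [|n IH].
    by rewrite /H big_nat1 /series/= big_geq// ln1 subr0 add0r.
  have -> : H n.+2 = H n.+1 + n.+2%:R^-1 by rewrite /H big_nat_recr.
  have -> : series v n.+1 = series v n + v n by rewrite /series/= big_nat_recr.
  have -> : series v n = H n.+1 - ln n.+1%:R - n.+1%:R^-1 by rewrite IH addrK.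
  rewrite /v (_ : 1 + n.+1%:R^-1 = n.+2%:R / n.+1%:R).
    by rewrite ln_div ?posrE//; ring.
  by rewrite -[n.+2%:R]natr1; field.
have h : H n.+1 - ln n.+1%:R @[n --> \oo] --> limn (series v) + 0.
  by under eq_fun do rewrite vE; apply: cvgD => //; exact: cvg_harmonic.
suff -> : euler_gamma R = limn (series v) + 0 by [].
apply/cvg_lim => //; move: h.
by rewrite -[X in _ -> X](cvg_shiftS (fun N => H N - ln N%:R)).
Qed.

Let barnes_prod0 N : barnes_prod 0 N = 1.
Proof.
rewrite /barnes_prod big1// => k _.
by rewrite /barnes_factor mul0r addr0 expr1n expr0n/= mul0r subrr expR0 mulr1.
Qed.

Let barnes_prod1 N :
  barnes_prod 1 N * Gamma (N%:R + 1) = (N%:R + 1) ^+ N * expR (2^-1 * H N - N%:R).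
Proof.
have := @barnes_prodS 0 N; rewrite barnes_prod0 !addr0 !add0r Gamma1 !mul1r.
by apply; rewrite ltrN10.
Qed.

Let rho x n : R := Gamma (n.+1%:R + x) / (Gamma n.+1%:R * n.+1%:R `^ x).

(** Dividing [barnes_prodS] by its case w = 0 eliminates the factor (N+1)^N e^(-N), whose
    asymptotics would need Stirling's formula; the price is the still unknown limit [L1]. *)
Let limit_prodS w (Lw Lw1 L1 : R) : -1 < w ->
  barnes_prod w N @[N --> \oo] --> Lw ->
  barnes_prod (w + 1) N @[N --> \oo] --> Lw1 ->
  barnes_prod 1 N @[N --> \oo] --> L1 ->
  Lw1 = Lw * L1 * Gamma (1 + w) * expR w * expR (w * euler_gamma R).
Proof.
move=> w1 cw cw1 c1; have w10 : 0 < 1 + w by rewrite -ltrBlDl sub0r.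
have E n : barnes_prod (w + 1) n.+1 = barnes_prod w n.+1 * barnes_prod 1 n.+1 *
    Gamma (1 + w) * (1 + w / n.+2%:R) ^+ n.+1 *
    expR (w * (H n.+1 - ln n.+1%:R)) / rho (1 + w) n.
  have N0 : 0 < (n.+1%:R : R) by [].
  have N1 : 0 < (n.+1%:R + 1 : R) by rewrite addr_gt0.
  have Gw0 := Gamma_gt0 (addr_gt0 N0 w10).
  have S := @barnes_prodS w n.+1 w1; have S1 := barnes_prod1 n.+1.
  rewrite /rho powRD_gt0// powRr1 ?(ltW N0)//.
  have -> : n.+1%:R `^ w = expR (w * ln n.+1%:R) by rewrite /powR gt_eqF.
  have -> : w * (H n.+1 - ln n.+1%:R) = w * H n.+1 - w * ln n.+1%:R by rewrite mulrBr.
  have -> : 1 + w / n.+2%:R = (n.+1%:R + 1 + w) / (n.+1%:R + 1).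
    by rewrite natr1; field.
  rewrite expRD expRN expr_div_n addrA; rewrite addrA in Gw0.
  rewrite (GammaS N0) in S1.
  have EE : expR ((w + 2^-1) * H n.+1 - n.+1%:R) =
      expR (w * H n.+1) * expR (2^-1 * H n.+1 - n.+1%:R).
    by rewrite -expRD; congr expR; ring.
  rewrite EE in S; move: S S1 (Gamma_gt0 N0) Gw0 (exprn_gt0 n.+1 N1).
  move: (expR_gt0 (w * ln n.+1%:R)) N0; clear.
  move: (barnes_prod (w + 1) n.+1) (barnes_prod w n.+1) (barnes_prod 1 n.+1).
  move: (Gamma (1 + w)) (Gamma n.+1%:R) (Gamma (n.+1%:R + 1 + w)).
  move: ((n.+1%:R + 1 + w) ^+ n.+1) ((n.+1%:R + 1) ^+ n.+1).
  move: (expR (w * ln n.+1%:R)) (expR (w * H n.+1)).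
  move: (expR (2^-1 * H n.+1 - n.+1%:R)).
  move: (n.+1%:R : R).
  move=> N E2 E4 E3 A B G1w GN Gw X Pw P1 E40 N0 S S1 GN0 Gw0 B0.
  have -> : X = Pw * (G1w * A * (E3 * E2)) / Gw by rewrite -S mulfK// gt_eqF.
  have -> : P1 = B * E2 / (N * GN) by rewrite -S1 mulfK// mulf_neq0// gt_eqF.
  by field; rewrite !gt_eqF.
have c (v L : R) : barnes_prod v N @[N --> \oo] --> L ->
    barnes_prod v n.+1 @[n --> \oo] --> L.
  by rewrite -(cvg_shiftS (barnes_prod v)).
have cE : barnes_prod (w + 1) n.+1 @[n --> \oo] -->
    Lw * L1 * Gamma (1 + w) * expR w * expR (w * euler_gamma R) / 1.
  under eq_fun do rewrite E.
  apply: cvgM; last by apply: cvgV => //; exact: Gamma_ratio_cvg.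
  apply: cvgM; last first.
    apply: continuous_cvg; first exact: continuous_expR.
    by apply: cvgM; [exact: cvg_cst|exact: euler_gamma_cvg].
  apply: cvgM; last exact: pow_cvg.
  apply: cvgM; last exact: cvg_cst.
  by apply: cvgM; exact: c.
by rewrite (cvg_unique _ (c _ _ cw1) cE)// divr1.
Qed.

Let Gamma_double N : Gamma ((2 * N)%:R + 1) * Gamma 2^-1 =
  4 ^+ N * Gamma (N%:R + 1) * Gamma (N%:R + 2^-1) :> R.
Proof.
have h0 : 0 < (2^-1 : R) by rewrite invr_gt0.
elim: N => [|N IH]; first by rewrite muln0 !add0r expr0 mul1r.
have N0 : 0 <= N%:R :> R by [].
have -> : (2 * N.+1)%:R + 1 = (2 * N)%:R + 1 + 1 + 1 :> R by rewrite mulnS natrD; ring.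
have X0 : 0 <= (2 * N)%:R :> R by [].
have p1 : 0 < (2 * N)%:R + 1 :> R by rewrite ltr_wpDl.
have p2 : 0 < (2 * N)%:R + 1 + 1 :> R by rewrite addr_gt0.
have p3 : 0 < N%:R + 1 :> R by rewrite ltr_wpDl.
have p4 : 0 < N%:R + 2^-1 :> R by rewrite ltr_wpDl.
rewrite (GammaS p2) (GammaS p1) -[N.+1%:R]natr1 (GammaS p3).
rewrite [N%:R + 1 + 2^-1]addrAC (GammaS p4) exprS.
rewrite -mulrA -[_ * Gamma ((2 * N)%:R + 1) * _]mulrA IH natrM.
by move: (Gamma (N%:R + 1)) (Gamma (N%:R + 2^-1)) => A B; field.
Qed.

(** By [Gamma_double], the product at 2N is the square of the product at N times factors with known
    limits. Hence L1 equals L1^2 times a constant, and L1 > 0 allows cancelling. The square root of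
    2 pi comes from Gamma(1/2) and 2^(1/2). *)
Let limit_prod1 (L1 : R) : 0 < L1 -> barnes_prod 1 N @[N --> \oo] --> L1 ->
  L1 * (2 * pi) `^ 2^-1 = expR (1 + euler_gamma R / 2).
Proof.
move=> L10 c1; have h0 : 0 < (2^-1 : R) by rewrite invr_gt0.
pose a n : R := H n.+1 - ln n.+1%:R.
(* With N = n+1, the squared power arises from (2N+1)^(2N) = 4^N (N+1/2)^(2N) divided by (N+1)^(2N);
   the 4^N cancels against the duplication formula. *)
have E n : barnes_prod 1 (2 * n.+1) = barnes_prod 1 n.+1 ^+ 2 *
    ((1 + - 2^-1 / n.+2%:R) ^+ n.+1) ^+ 2 * Gamma 2^-1 *
    (expR (a (2 * n).+1 * 2^-1 - a n) * 2 `^ 2^-1 / rho 2^-1 n).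
  have N0 : 0 < (n.+1%:R : R) by [].
  have N1 : 0 < (n.+1%:R + 1 : R) by rewrite addr_gt0.
  have Gh := Gamma_gt0 (addr_gt0 N0 h0).
  have S2 := barnes_prod1 (2 * n.+1); have S1 := barnes_prod1 n.+1.
  have D := Gamma_double n.+1.
  have E2N : (2 * n).+2 = (2 * n.+1)%N by rewrite mulnS.
  have -> : expR (a (2 * n).+1 * 2^-1 - a n) * 2 `^ 2^-1 / rho 2^-1 n =
      expR (2^-1 * H (2 * n.+1)) / expR (H n.+1) * Gamma (n.+1%:R + 1)
        / Gamma (n.+1%:R + 2^-1).
    have -> : (2 : R) `^ 2^-1 = expR (2^-1 * ln 2) by rewrite /powR pnatr_eq0.
    rewrite /rho (_ : n.+1%:R `^ 2^-1 = expR (2^-1 * ln n.+1%:R)); last first.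
      by rewrite /powR gt_eqF.
    rewrite /a E2N natrM lnM ?posrE// -[expR (H n.+1)]invrK -[(expR (H n.+1))^-1]expRN.
    rewrite (GammaS N0) -[RHS]mulrA; set G1 := Gamma n.+1%:R.
    have EE : expR ((H (2 * n.+1) - (ln 2%:R + ln n.+1%:R)) * 2^-1 -
        (H n.+1 - ln n.+1%:R)) * expR (2^-1 * ln 2) =
      expR (2^-1 * H (2 * n.+1)) * expR (- H n.+1) * expR (2^-1 * ln n.+1%:R).
      by rewrite -!expRD; congr expR; field.
    have NE : expR (2^-1 * ln n.+1%:R) * expR (2^-1 * ln n.+1%:R) = n.+1%:R :> R.
      rewrite -expRD -mulrDl (_ : 2^-1 + 2^-1 = 1) ?mul1r ?lnK//.
      by field.
    rewrite EE invrK -[X in _ * (X * G1 / _)]NE /G1.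
    have := gt_eqF Gh; have := gt_eqF (Gamma_gt0 N0).
    have := gt_eqF (expR_gt0 (2^-1 * ln (n.+1%:R : R))).
    move: (Gamma n.+1%:R) (Gamma (n.+1%:R + 2^-1)) (expR (2^-1 * ln n.+1%:R)).
    by move=> x y z z0 x0 y0; field; rewrite x0 y0 z0.
  have powE : (1 + - 2^-1 / n.+2%:R) ^+ n.+1 =
      (n.+1%:R + 2^-1) ^+ n.+1 / (n.+1%:R + 1) ^+ n.+1 :> R.
    by rewrite -expr_div_n -[n.+2%:R]natr1; congr (_ ^+ _); field.
  have pow2E : ((2 * n.+1)%:R + 1) ^+ (2 * n.+1) =
      4 ^+ n.+1 * ((n.+1%:R + 2^-1) ^+ n.+1) ^+ 2 :> R.
    by rewrite exprM [in RHS]exprAC -exprMn natrM; congr (_ ^+ _); field.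
  have e2E : expR (2^-1 * H (2 * n.+1) - (2 * n.+1)%:R) =
      expR (2^-1 * H (2 * n.+1)) * expR (- n.+1%:R) ^+ 2.
    by rewrite -expRM_natl -expRD natrM; congr expR; ring.
  have e1E : expR (2^-1 * H n.+1 - n.+1%:R) = expR (2^-1 * H n.+1) * expR (- n.+1%:R).
    by rewrite -expRD.
  have eHE : expR (H n.+1) = expR (2^-1 * H n.+1) ^+ 2.
    by rewrite -expRM_natl; congr expR; field.
  rewrite powE eHE; rewrite pow2E e2E in S2; rewrite e1E in S1.
  have G20 : 0 < Gamma ((2 * n.+1)%:R + 1 : R) by rewrite Gamma_gt0// addr_gt0// ltr0n.
  move: S1 S2 D (Gamma_gt0 N1) Gh G20 (Gamma_gt0 h0) (exprn_gt0 n.+1 N1).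
  move: (expR_gt0 (2^-1 * H n.+1)) (exprn_gt0 n.+1 (ltr0n R 4)); clear.
  move: (barnes_prod 1 n.+1) (barnes_prod 1 (2 * n.+1)).
  move: (Gamma (n.+1%:R + 1)) (Gamma (n.+1%:R + 2^-1)) (Gamma ((2 * n.+1)%:R + 1)).
  move: (Gamma 2^-1) ((n.+1%:R + 1) ^+ n.+1) ((n.+1%:R + 2^-1) ^+ n.+1) (4 ^+ n.+1).
  move: (expR (2^-1 * H n.+1)) (expR (2^-1 * H (2 * n.+1))) (expR (- n.+1%:R)).
  move=> e1 e2 t Gh B F X4 G1 Gm G2 P1 P2 e10 X40 S1 S2 D G10 Gm0 G20 Gh0 B0.
  have -> : P1 = B * (e1 * t) / G1 by rewrite -S1 mulfK// gt_eqF.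
  have -> : P2 = X4 * F ^+ 2 * (e2 * t ^+ 2) / G2 by rewrite -S2 mulfK// gt_eqF.
  have -> : G2 = X4 * G1 * Gm / Gh by rewrite -D mulfK// gt_eqF.
  by field; rewrite !gt_eqF.
pose g := euler_gamma R.
have subseq (f : nat -> nat) : (forall n, (n <= f n)%N) -> f n @[n --> \oo] --> \oo.
  move=> hf; apply/cvgnyPge => A; near=> n; apply: leq_trans (hf n).
  by near: n; exact: nbhs_infty_ge.
have c2 : barnes_prod 1 (2 * n.+1) @[n --> \oo] --> L1.
  apply: (cvg_comp (fun n => 2 * n.+1)%N (barnes_prod 1) _ c1).
  by apply: subseq => n; rewrite mulnS; lia.
have ca2 : a (2 * n).+1 @[n --> \oo] --> g.
  apply: (cvg_comp (fun n => (2 * n).+1)%N a _ euler_gamma_cvg).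
  by apply: subseq => n; lia.
have cE : barnes_prod 1 (2 * n.+1) @[n --> \oo] --> L1 ^+ 2 *
    (expR (- 2^-1)) ^+ 2 * Gamma 2^-1 * (expR (g * 2^-1 - g) * 2 `^ 2^-1 / 1).
  under eq_fun do rewrite E.
  have cpow : (1 + - 2^-1 / n.+2%:R) ^+ n.+1 @[n --> \oo] --> expR (- 2^-1 : R).
    by apply: pow_cvg; rewrite ltrN2 invf_lt1// ltr1n.
  have cP : barnes_prod 1 n.+1 @[n --> \oo] --> L1.
    by rewrite (cvg_shiftS (barnes_prod 1)).
  apply: cvgM; last first.
    apply: cvgM; last by apply: cvgV => //; exact: Gamma_ratio_cvg.
    apply: cvgM; last exact: cvg_cst.
    apply: continuous_cvg; first exact: continuous_expR.
    apply: cvgB; last exact: euler_gamma_cvg.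
    by apply: cvgM => //; exact: cvg_cst.
  apply: cvgM; last exact: cvg_cst.
  by apply: cvgM; apply: cvgM.
have := cvg_lim (@Rhausdorff R) c2; rewrite (cvg_lim (@Rhausdorff R) cE) divr1.
have -> : Gamma (2^-1 : R) = pi `^ 2^-1.
  apply/eqP; rewrite -(@eqrXn2 _ 2)// ?powR_ge0 ?(ltW (Gamma_gt0 h0))//.
  rewrite Gamma_half -powR_mulrn ?powR_ge0// -powRrM mulVf ?pnatr_eq0//.
  by rewrite powRr1// pi_ge0.
rewrite powRM ?pi_ge0//.
have e1 : expR (- 2^-1) ^+ 2 * expR (g * 2^-1 - g) * expR (1 + g / 2) = 1.
  by rewrite -expRM_natl -!expRD -[RHS]expR0; congr expR; field.
move: (2 `^ 2^-1) (pi `^ 2^-1) e1 => s p; rewrite -/g.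
move: (expR (- 2^-1)) (expR (g * 2^-1 - g)) (expR (1 + g / 2)) => e f k e1 LE.
have e2 : L1 * (e ^+ 2 * f) * (s * p) = 1.
  apply: (mulfI (lt0r_neq0 L10)); rewrite mulr1 -[RHS]LE; ring.
by rewrite -[LHS]mul1r -e1 -[RHS]mulr1 -e2; ring.
Unshelve. all: by end_near. Qed.

Let barnesGE w L : barnes_prod w N @[N --> \oo] --> L ->
  barnesG (1 + w) = (2 * pi) `^ (w / 2) *
    expR (- ((w + (1 + euler_gamma R) * w ^+ 2) / 2)) * L.
Proof.
move=> cL; rewrite /barnesG [1 + w]addrC addrK; congr (_ * _).
exact: (cvg_lim (@Rhausdorff R) cL).
Qed.

Lemma barnesG_gt0 z : 0 < z -> 0 < barnesG z.
Proof.
move=> z0; have w1 : -1 < z - 1 by rewrite ltrBDr addrC subrr.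
have [L L0 cL] := barnes_prod_cvg w1.
rewrite -[z](subrK 1) addrC (barnesGE cL) !mulr_gt0 ?expR_gt0 ?powR_gt0//.
by rewrite mulr_gt0// pi_gt0.
Qed.

Lemma barnesG1 : barnesG (1 : R) = 1.
Proof.
have c0 : barnes_prod 0 N @[N --> \oo] --> (1 : R).
  by under eq_fun do rewrite barnes_prod0; exact: cvg_cst.
rewrite -[1 in LHS]addr0 (barnesGE c0).
by rewrite mul0r powRr0 expr0n/= mulr0 addr0 mul0r oppr0 expR0 !mulr1.
Qed.

(** The quotient of the prefactors at w+1 and w, with [L1] from [limit_prod1], cancels everything in
    [limit_prodS] except Gamma. *)
Lemma barnesGS z : 0 < z -> barnesG (z + 1) = Gamma z * barnesG z.
Proof.
move=> z0; pose w := z - 1; have w1 : -1 < w by rewrite ltrBDr addrC subrr.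
have zw : z = 1 + w by rewrite addrC subrK.
have [Lw Lw0 cw] := barnes_prod_cvg w1.
have w11 : -1 < w + 1 by rewrite (lt_trans w1)// ltrDl.
have [Lw1 Lw10 cw1] := barnes_prod_cvg w11.
have one1 : -1 < (1 : R) by rewrite (lt_trans _ ltr01)// ltrN10.
have [L1 L10 c1] := barnes_prod_cvg one1.
have E1 := limit_prodS w1 cw cw1 c1; have E2 := limit_prod1 L10 c1.
rewrite zw -addrA (barnesGE cw) (barnesGE cw1) E1 [(w + 1) / 2]mulrDl powRD_gt0; last first.
  by rewrite mulr_gt0// pi_gt0.
rewrite mul1r; move: E2; set g := euler_gamma R; set s := _ `^ 2^-1; set p := _ `^ _ => E2.
have <- : expR (- ((w + 1 + (1 + g) * (w + 1) ^+ 2) / 2)) * expR w * expR (w * g) *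
   expR (1 + g / 2) = expR (- ((w + (1 + g) * w ^+ 2) / 2)).
  by rewrite -!expRD; congr expR; field.
by rewrite -E2; ring.
Qed.

End BarnesProduct.

(** * The deformed Jacobi weight *)

Section Moments.
Context {R : realType}.
Notation mu := (@lebesgue_measure R).
Variables (a b : R).
Hypothesis a_gtN1 : -1 < a.
Hypothesis b_gtN1 : -1 < b.
Implicit Types (l x : R) (k n : nat) (p q : {poly R}).

Definition moment k l := \int[mu]_(x in `[0%R, 1%R]) (x ^+ k * weight l a b x).
Local Notation M := (moments_at moment).

Let a10 : 0 < a + 1. Proof. by rewrite -ltrBlDr sub0r. Qed.
Let b10 : 0 < b + 1. Proof. by rewrite -ltrBlDr sub0r. Qed.

Let measurable_weight l : measurable_fun setT (weight l a b).
Proof.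
rewrite (_ : weight l a b = fun x => beta_ker (a + 1) (b + 1) x * expR (- l * x)).
  apply: measurable_funM; first exact: measurable_beta_ker.
  by apply: measurableT_comp.
by apply/funext => x; rewrite /weight /beta_ker !addrK.
Qed.

Let measurable_poly_weight p l : measurable_fun setT (fun x => p.[x] * weight l a b x).
Proof.
apply: measurable_funM => //; apply: continuous_measurable_fun.
exact: continuous_horner.
Qed.

(** Passing to the open interval discards the conventional endpoint values of [powR]. *)
Lemma Rintegral_poly_weight p l :
  \int[mu]_(x in `[0%R, 1%R]) (p.[x] * weight l a b x) =
  \int[mu]_(x in `]0%R, 1%R[) (p.[x] * weight l a b x).
Proof.
rewrite /Rintegral integral_itv_bndoo//; apply/measurable_EFinP.
by apply: measurable_funTS; exact: measurable_poly_weight.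
Qed.

Let weight_le l x : 0 < x < 1 ->
  0 <= weight l a b x <= expR `|l| * beta_ker (a + 1) (b + 1) x.
Proof.
move=> /andP[x0 x1]; rewrite /weight /beta_ker !addrK.
rewrite !mulr_ge0 ?powR_ge0 ?expR_ge0//= mulrC ler_wpM2r ?mulr_ge0 ?powR_ge0//.
rewrite ler_expR (le_trans (ler_norm _))// normrM normrN (gtr0_norm x0).
by rewrite ler_piMr// ltW.
Qed.

Let integrable_bound (C : R) :
  mu.-integrable `]0, 1[ (EFin \o (fun x => C * beta_ker (a + 1) (b + 1) x)).
Proof.
have i := integrable_beta_ker a10 b10.
suff : mu.-integrable `]0, 1[
  (EFin \o (fun x => C * beta_ker (a + 1) (b + 1) x + 0 * beta_ker (a + 1) (b + 1) x)).
  by congr (integrable _ _ _); apply/funext => x /=; rewrite mul0r addr0.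
exact: integrable_lin.
Qed.

Lemma integrable_Xn_weight k l :
  mu.-integrable `]0, 1[ (EFin \o (fun x => x ^+ k * weight l a b x)).
Proof.
apply: (le_integrableR _ _ _ (integrable_bound (expR `|l|))) => //.
  apply: measurable_funTS; have := measurable_poly_weight 'X^k l.
  by under eq_fun do rewrite hornerXn.
move=> x; rewrite /= in_itv/= => /[dup] x01 /andP[x0 x1].
have /andP[w0 wC] := weight_le l x01.
rewrite ger0_norm; last by apply: mulr_ge0 => //; rewrite exprn_ge0// ltW.
by apply: le_trans wC; rewrite ler_piMl// exprn_ile1// ltW.
Qed.

Lemma momentE k l : moment k l = \int[mu]_(x in `]0%R, 1%R[) (x ^+ k * weight l a b x).
Proof.
have := Rintegral_poly_weight 'X^k l.
by under eq_Rintegral do rewrite hornerXn; under [in RHS]eq_Rintegral do rewrite hornerXn.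
Qed.

Lemma moment0 k : moment k 0 = Beta (a + 1 + k%:R) (b + 1).
Proof.
rewrite momentE; apply: eq_Rintegral => x; rewrite inE/= in_itv/= => /andP[x0 x1].
rewrite /weight /beta_ker oppr0 mul0r expR0 mulr1 addrK mulrA addrAC addrK.
by rewrite powRD_gt0// powR_mulrn ?(ltW x0)// [x ^+ k * _]mulrC.
Qed.

(** [BetaS] read on moments: together with positivity, all that the computation of the Jacobi
    coefficients knows about the weight. *)
Lemma moment0_rec k :
  (a + 1 + k%:R) * moment k 0 = (a + b + 2 + k%:R) * moment k.+1 0.
Proof.
have Ak : 0 < a + 1 + k%:R by rewrite ltr_pwDl.
rewrite !moment0 -BetaS; last 2 first; [exact: Ak|exact: b10|].
rewrite (_ : a + 1 + k.+1%:R = a + 1 + k%:R + 1).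
  by congr (_ * _); ring.
by rewrite -[k.+1%:R]natr1 addrA.
Qed.

Lemma is_derive_moment k l : is_derive l 1 (moment k) (- moment k.+1 l).
Proof.
pose f (t x : R) := x ^+ k * weight t a b x.
have df (x t : R) : is_derive t 1 (f ^~ x) (- (x ^+ k.+1 * weight t a b x)).
  pose c := x ^+ k * (x `^ a * (1 - x) `^ b).
  have h1 : is_derive t 1 (fun s => - s * x) (- x).
    rewrite (_ : (fun s => _) = (- x) *: id); last first.
      by apply/funext => s; rewrite fctE /GRing.scale/=; ring.
    by apply: is_derive_eq; rewrite /GRing.scale/= mulr1.
  have h2 := @is_derive1_comp R expR (fun s => - s * x) t _ _ (is_derive_expR _) h1.
  rewrite (_ : f ^~ x = c *: (expR \o (fun s : R => - s * x))); last first.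
    by apply/funext => s; rewrite /f /weight /c fctE /GRing.scale/= !mulrA.
  by apply: is_derive_eq (is_deriveZ c h2) _;
    rewrite /GRing.scale/= /c /weight exprS; ring.
(* A bound for the lambda-derivative of the integrand that is uniform for parameters within 1 of
   [l], as differentiation under the integral demands. *)
pose G x := expR (`|l| + 1) * `|beta_ker (a + 1) (b + 1) x|.
have Il : `]l - 1, l + 1[%classic l by rewrite /= in_itv/= ltrBlDr ltrDl ltr01.
have intf (t : R) : `]l - 1, l + 1[%classic t -> mu.-integrable `]0, 1[ (EFin \o f t).
  by move=> _; exact: integrable_Xn_weight.
have G0 (x : R) : 0 <= G x by rewrite mulr_ge0// expR_ge0.
have intG : mu.-integrable `]0, 1[ (EFin \o G).
  have := integrable_bound (expR (`|l| + 1)).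
  congr (integrable _ _ _); apply/funext => x /=.
  by rewrite /G [`|beta_ker _ _ _|]ger0_norm ?beta_ker_ge0.
have Gub (t x : R) : `]l - 1, l + 1[%classic t -> `]0, 1[%classic x ->
    `|partial1of2 f t x| <= G x.
  rewrite /= !in_itv/= => /andP[t1 t2] /[dup] x01 /andP[x0 x1].
  have [_] := df x t; rewrite partial1of2E => ->.
  have /andP[w0 wC] := weight_le t x01.
  rewrite normrN ger0_norm; last by apply: mulr_ge0 => //; rewrite exprn_ge0// ltW.
  apply: (@le_trans _ _ (weight t a b x)).
    by rewrite ler_piMl// exprn_ile1// ltW.
  rewrite (le_trans wC)// /G [`|beta_ker _ _ _|]ger0_norm ?beta_ker_ge0//.
  rewrite ler_wpM2r ?beta_ker_ge0//.
  rewrite ler_expR -lerBlDl (le_trans (lerB_dist _ _))// ler_norml.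
  by apply/andP; split; lra.
have dfx (t x : R) : `]l - 1, l + 1[%classic t -> `]0, 1[%classic x -> derivable (f ^~ x) t 1.
  by move=> _ _; have [] := df x t.
have mD : measurable (`]0, 1[%classic : set (measurableTypeR R)) by [].
have H1 := derivable_under_integral mD Il intf dfx G0 intG Gub.
have H2 := differentiation_under_integral mD Il intf dfx G0 intG Gub.
have -> : moment k = fun t => \int[mu]_(x in `]0%R, 1%R[) f t x.
  by apply/funext => t; rewrite momentE.
apply: DeriveDef => //; rewrite -derive1E H2 momentE.
rewrite -[RHS]mulN1r -RintegralZl//; last exact: integrable_Xn_weight.
by apply: eq_Rintegral => x _; rewrite partial1of2E mulN1r; have [_ ->] := df x l.
Qed.

Let integral_poly_weight_widen p l n : (size p <= n)%N ->
  mu.-integrable `]0, 1[ (EFin \o (fun x => p.[x] * weight l a b x)) /\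
  \int[mu]_(x in `]0%R, 1%R[) (p.[x] * weight l a b x) = \sum_(i < n) p`_i * M l i.
Proof.
move=> sp; have pE : (fun x => p.[x] * weight l a b x) =
    fun x => \sum_(i < n) p`_i * (x ^+ i * weight l a b x).
  apply/funext => x; rewrite (horner_coef_wide _ sp) mulr_suml; apply: eq_bigr => i _.
  by rewrite -[LHS]mulrA.
rewrite pE; elim: n {sp pE} => [|n [IHi IHe]].
  rewrite (_ : (fun x => \sum_(i < 0) _) = cst 0).
    by split; [exact: integrable0|rewrite big_ord0 Rintegral_cst// mul0r].
  by apply/funext => x; rewrite big_ord0.
have E : (fun x => \sum_(i < n.+1) p`_i * (x ^+ i * weight l a b x)) =
    (fun x => 1 * (\sum_(i < n) p`_i * (x ^+ i * weight l a b x)) +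
      p`_n * (x ^+ n * weight l a b x)).
  by apply/funext => x; rewrite big_ord_recr mul1r.
split; first by rewrite E; apply: integrable_lin => //; exact: integrable_Xn_weight.
rewrite E Rintegral_lin//; last exact: integrable_Xn_weight.
by rewrite mul1r IHe big_ord_recr/= [M l n]momentE.
Qed.

Lemma integrable_poly_weight p l :
  mu.-integrable `]0, 1[ (EFin \o (fun x => p.[x] * weight l a b x)).
Proof. by have [] := integral_poly_weight_widen l (leqnn (size p)). Qed.

Lemma moment_functionalE p l : moment_functional (M l) p =
  \int[mu]_(x in `]0%R, 1%R[) (p.[x] * weight l a b x).
Proof. by have [_ ->] := integral_poly_weight_widen l (leqnn (size p)). Qed.

Lemma moment_functional_gt0 l p : p != 0 -> 0 < moment_functional (M l) (p * p).
Proof.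
move=> p0; rewrite moment_functionalE.
have [x x01 px] : exists2 x : R, 0 < x < 1 & p.[x] != 0.
  (* These are [size p] distinct points of (0, 1), more than p has roots; near one that is not a
     root the integrand is strictly positive. *)
  pose rs : seq R := [seq i.+2%:R^-1 | i <- iota 0 (size p)].
  have /allPn[x /mapP[i _ ->] px] : ~~ all (root p) rs.
    apply/negP => /(max_poly_roots p0); rewrite /rs size_map size_iota ltnn => h.
    apply: notF; apply: h; rewrite map_inj_uniq ?iota_uniq// => i j.
    by move=> /invr_inj/eqP; rewrite eqr_nat => /eqP[].
  exists i.+2%:R^-1 => //.
  by rewrite invr_gt0 ltr0n invf_lt1 ?ltr1n.
have /andP[x0 x1] := x01.
apply: (@Rintegral_gt0 R _ _ x) => //.
- exact: integrable_poly_weight.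
- move=> y; rewrite /= in_itv/= hornerM => y01.
  by have /andP[w0 _] := weight_le l y01; rewrite mulr_ge0// -expr2 sqr_ge0.
- rewrite hornerM; apply: mulr_gt0; first by rewrite -expr2 exprn_even_gt0.
  by rewrite /weight !mulr_gt0 ?powR_gt0 ?subr_gt0 ?expR_gt0.
- apply: continuousM; first exact: continuous_horner.
  rewrite (_ : weight l a b = fun x => beta_ker (a + 1) (b + 1) x * expR (- l * x)).
    apply: continuousM; first exact: continuous_beta_ker.
    apply: continuous_comp; last exact: continuous_expR.
    exact: mulrl_continuous.
  by apply/funext => y; rewrite /weight /beta_ker !addrK.
Qed.

Lemma monic_orthogonalE n l : monic_orthogonal n l a b = op (M l) n.
Proof.
have orthE p q : \int[mu]_(x in `[0%R, 1%R]) (p.[x] * q.[x] * weight l a b x) =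
    moment_functional (M l) (p * q).
  rewrite moment_functionalE -Rintegral_poly_weight.
  by apply: eq_Rintegral => x _; rewrite hornerM.
have h : is_monic_orthogonal n l a b (op (M l) n).
  split; [exact: op_monic|exact: size_op|move=> q qn].
  by rewrite orthE op_orth//; exact: moment_functional_gt0.
rewrite /monic_orthogonal; case: xgetP => [_ -> [mp sp op]|/(_ _ h)//].
apply: op_unique => //; first exact: moment_functional_gt0.
by move=> r rn; rewrite -orthE op.
Qed.

Lemma subleadingE n l : (0 < n)%N -> subleading n l a b = ('X * op (M l) n)`_n.
Proof. by case: n => // n _; rewrite /subleading monic_orthogonalE coefXM. Qed.

Lemma hankel_detE n l : hankel_det n l a b = op_hankel moment n l.
Proof.
rewrite -op_hankelE; last exact: moment_functional_gt0.
by congr (\det _); apply/matrixP => i j; rewrite !mxE.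
Qed.

Lemma hankel_det_gt0 n l : 0 < hankel_det n l a b.
Proof. by rewrite hankel_detE op_hankel_gt0//; exact: moment_functional_gt0. Qed.

(** For s nonzero the terms in n s and n (n + b) cancel those of [sigma], leaving p(n, s), the
    logarithmic derivative of the determinant. *)
Lemma hankel_det_exp_integral n l : (0 < n)%N ->
  hankel_det n l a b = hankel_det n 0 a b *
    expR (oriented_integral 0 l (fun s =>
      (- sigma n (- s) a b - n%:R * s - n%:R * (n%:R + b)) / s)).
Proof.
move=> n0; pose F t : R := ln (op_hankel moment n t).
pose f (t : R) : R := ('X * op (M t) n)`_n.
pose g s : R := (- sigma n (- s) a b - n%:R * s - n%:R * (n%:R + b)) / s.
have gf s : s != 0 -> g s = f s.
  by move=> s0; rewrite /g /sigma opprK subleadingE// -/(f s); field.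
have dF (x : R) : is_derive x 1 F (f x).
  exact (@is_derive_ln_op_hankel R moment is_derive_moment
    (fun l p => @moment_functional_gt0 l p) n x).
have cf : continuous f.
  move=> x; apply/differentiable_continuous/derivable1_diffP.
  have [df _] := @is_derive_op_subleading R moment is_derive_moment
    (fun l p => @moment_functional_gt0 l p) n x.
  exact: df.
have cF : continuous F.
  by move=> x; apply/differentiable_continuous/derivable1_diffP.
have FTC u v : u < v -> u = 0 \/ v = 0 ->
    \int[mu]_(x in `[u, v]) g x = F v - F u.
  (* Zero is an endpoint of the interval, so the division by zero in [g] at s = 0 is invisible to
     the integral. *)
  move=> uv uv0; have gf' : {in `]u, v[%R, g =1 f}.
    move=> s; rewrite in_itv/= => /andP[us sv]; apply: gf.
    by case: uv0 => h; rewrite -h ?(gt_eqF us) ?(lt_eqF sv).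
  have mf : measurable_fun (`]u, v[%classic : set R) f.
    by apply: measurable_funTS; exact: continuous_measurable_fun.
  rewrite /Rintegral (@eq_integral_itv_bounded _ _ _ f)//; last first.
    by apply: eq_measurable_fun mf => s /set_mem /gf' ->.
  rewrite (@continuous_FTC2 _ f F)//.
  - exact: continuous_subspaceT.
  - split; [by move=> x _|apply: cvg_at_right_filter; exact: cF|
      apply: cvg_at_left_filter; exact: cF].
  - by move=> x _; rewrite derive1E; have [] := dF x.
suff -> : oriented_integral 0 l g = F l - F 0.
  have expRB_eq (d e u v : R) : expR u = e -> expR v = d -> e = d * expR (u - v).
    by move=> <- <-; rewrite expRB mulrC divfK// gt_eqF// expR_gt0.
  have Fe t : expR (F t) = hankel_det n t a b.
    by rewrite /F -hankel_detE lnK// posrE hankel_det_gt0.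
  exact (expRB_eq _ _ _ _ (Fe l) (Fe 0)).
rewrite /oriented_integral; have [l0|l0|<-] := ltgtP 0 l.
- by rewrite FTC//; left.
- by rewrite FTC// ?opprB//; right.
- by rewrite set_itv1 Rintegral_set1 subrr.
Qed.

End Moments.

Lemma op_hankelS {R : realType} (m : nat -> R -> R) n x :
  op_hankel m n.+1 x = op_hankel m n x * op_norm (moments_at m x) n.
Proof. by rewrite /op_hankel big_ord_recr. Qed.

Lemma Gamma_addr1 {R : realType} {y z : R} :
  0 < z -> y = z + 1 -> Gamma y = z * Gamma z.
Proof. by move=> z0 ->; exact: GammaS. Qed.

Lemma barnesG_addr1 {R : realType} {y z : R} :
  0 < z -> y = z + 1 -> barnesG y = Gamma z * barnesG z.
Proof. by move=> z0 ->; exact: barnesGS. Qed.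

(** * Norms at lambda = 0 and the closed forms of D_n(0) *)

Section JacobiHankel.
Context {R : realType} {a b : R}.
Hypothesis a_gtN1 : -1 < a.
Hypothesis b_gtN1 : -1 < b.

Local Notation M := (moments_at (moment a b) 0).

Let m_pos p : p != 0 -> 0 < moment_functional M (p * p).
Proof. exact: moment_functional_gt0. Qed.

Let m_rec k : (a + 1 + k%:R) * M k = (a + b + 2 + k%:R) * M k.+1.
Proof. exact: moment0_rec. Qed.

Let S_ab1_gt0 (n : nat) : 0 < n.+1%:R + a + b + 1 :> R.
Proof.
have a10 : 0 < a + 1 by rewrite -ltrBlDr sub0r.
have b10 : 0 < b + 1 by rewrite -ltrBlDr sub0r.
have n0 : 0 <= n%:R :> R by [].
by rewrite -natr1; lra.
Qed.

Let A2_neq1 (n : nat) : 2 * n.+2%:R + a + b - 1 != 0 :> R.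
Proof.
have n0 : 0 <= n.+1%:R :> R by [].
by rewrite gt_eqF// -natr1; move: (S_ab1_gt0 n) n0 => *; lra.
Qed.

Let op_norm0 : op_norm M 0 = Gamma (a + 1) * Gamma (b + 1) / Gamma (a + b + 2).
Proof.
have a10 : 0 < a + 1 by rewrite -ltrBlDr sub0r.
have b10 : 0 < b + 1 by rewrite -ltrBlDr sub0r.
have -> : op_norm M 0 = moment a b 0 0.
  by rewrite /op_norm op0 mulr1 -(expr0 'X) moment_functionalXn.
rewrite -(_ : a + 1 + (b + 1) = a + b + 2); last by ring.
by rewrite -BetaE// -[a + 1 in RHS]addr0; exact: moment0.
Qed.

(** The squared norm of P_n at x = n >= 1. At x = 0 the argument a + b + 1 may be nonpositive, so
    the norm of P_0 is kept in its reduced form [op_norm0]. *)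
Let jacobi_norm (x : R) : R :=
  Gamma (x + 1) * Gamma (x + a + 1) * Gamma (x + b + 1) * Gamma (x + a + b + 1)
  / (Gamma (2 * x + a + b + 1) * Gamma (2 * x + a + b + 2)).

Let jacobi_normS (x : R) : 0 < x -> 0 < x + a + b + 1 ->
  jacobi_norm (x + 1) = jac_beta (a + b) (a - b) (2 * (x + 1) + a + b) * jacobi_norm x.
Proof.
move=> x0 xab0.
have a10 : 0 < a + 1 by rewrite -ltrBlDr sub0r.
have b10 : 0 < b + 1 by rewrite -ltrBlDr sub0r.
have xa0 : 0 < x + a + 1 by lra.
have xb0 : 0 < x + b + 1 by lra.
have x10 : 0 < x + 1 by lra.
have y0 : 0 < 2 * x + a + b + 1 by lra.
have y1 : 0 < 2 * x + a + b + 2 by lra.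
have y2 : 0 < 2 * x + a + b + 3 by lra.
have E1 : Gamma (x + 1 + 1) = (x + 1) * Gamma (x + 1) by exact: Gamma_addr1.
have E2 : Gamma (x + 1 + a + 1) = (x + a + 1) * Gamma (x + a + 1).
  by apply: Gamma_addr1 => //; ring.
have E3 : Gamma (x + 1 + b + 1) = (x + b + 1) * Gamma (x + b + 1).
  by apply: Gamma_addr1 => //; ring.
have E4 : Gamma (x + 1 + a + b + 1) = (x + a + b + 1) * Gamma (x + a + b + 1).
  by apply: Gamma_addr1 => //; ring.
have E5 : Gamma (2 * x + a + b + 2) = (2 * x + a + b + 1) * Gamma (2 * x + a + b + 1).
  by apply: Gamma_addr1 => //; ring.
have E6 : Gamma (2 * x + a + b + 3) = (2 * x + a + b + 2) * Gamma (2 * x + a + b + 2).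
  by apply: Gamma_addr1 => //; ring.
have E7 : Gamma (2 * (x + 1) + a + b + 2) = (2 * x + a + b + 3) * Gamma (2 * x + a + b + 3).
  by apply: Gamma_addr1 => //; ring.
have E8 : Gamma (2 * (x + 1) + a + b + 1) = Gamma (2 * x + a + b + 3).
  by congr Gamma; ring.
have G0 := Gamma_gt0 y0.
rewrite /jacobi_norm E1 E2 E3 E4 E7 E8 E6 E5 /jac_beta.
move: (Gamma (2 * x + a + b + 1)) G0 => g g0.
move: (Gamma (x + a + b + 1)) => g4; move: (Gamma (x + a + 1)) => g2.
move: (Gamma (x + b + 1)) => g3; move: (Gamma (x + 1)) => g1.
clear -x0 xab0 g0 y0 y1 y2.
by field; do ?(apply/andP; split); rewrite gt_eqF//; lra.
Qed.

Let op_normS k : op_norm M k.+1 = op_beta M k.+1 * op_norm M k.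
Proof. by rewrite /op_beta divfK// gt_eqF// op_norm_gt0. Qed.

(** The base case goes through [jacobi_beta1], since [jac_beta] is unusable at index 1 when a + b =
    -1. *)
Let op_norm1_jacobi : op_norm M 1 = jacobi_norm 1.
Proof.
have a10 : 0 < a + 1 by rewrite -ltrBlDr sub0r.
have b10 : 0 < b + 1 by rewrite -ltrBlDr sub0r.
have y1 : 0 < a + b + 2 by lra.
have y2 : 0 < a + b + 3 by lra.
rewrite op_normS op_norm0 (jacobi_beta1 m_pos a_gtN1 b_gtN1 m_rec) /jacobi_norm.
have E1 : Gamma (1 + 1) = 1 :> R by rewrite (Gamma_addr1 ltr01 erefl) Gamma1 mulr1.
have E2 : Gamma (1 + a + 1) = (a + 1) * Gamma (a + 1).
  by apply: Gamma_addr1 => //; ring.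
have E3 : Gamma (1 + b + 1) = (b + 1) * Gamma (b + 1).
  by apply: Gamma_addr1 => //; ring.
have E4 : Gamma (1 + a + b + 1) = Gamma (a + b + 2) by congr Gamma; ring.
have E5 : Gamma (2 * 1 + a + b + 1) = (a + b + 2) * Gamma (a + b + 2).
  by apply: Gamma_addr1 => //; ring.
have E6 : Gamma (2 * 1 + a + b + 2) = (a + b + 3) * Gamma (2 * 1 + a + b + 1).
  rewrite (_ : 2 * 1 + a + b + 1 = a + b + 3); last by ring.
  by apply: Gamma_addr1 => //; ring.
rewrite E1 E2 E3 E4 E6 E5; have := Gamma_gt0 y1.
move: (Gamma (a + b + 2)) => g g0; move: (Gamma (a + 1)) (Gamma (b + 1)) => g1 g2.
move: g0 y1 y2 => /lt0r_neq0 g0 /lt0r_neq0 y1 /lt0r_neq0 y2.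
by nonzero_field.
Qed.

Lemma op_norm_jacobi n : op_norm M n.+1 = jacobi_norm n.+1%:R.
Proof.
elim: n => [|n IH]; first exact: op_norm1_jacobi.
rewrite op_normS IH (jacobi_beta m_pos a_gtN1 b_gtN1 m_rec); last exact: A2_neq1.
by rewrite -[n.+2%:R]natr1 jacobi_normS//; exact: S_ab1_gt0.
Qed.

Let barnes_ratio (x : R) : R := barnesG (x + 1) *
  (barnesG (x + a + 1) * barnesG (x + b + 1) * barnesG (x + a + b + 1)
   / (barnesG (a + 1) * barnesG (b + 1) * barnesG (2 * x + a + b + 1))).

Let barnes_ratioS (x : R) : 0 < x -> 0 < x + a + b + 1 ->
  barnes_ratio (x + 1) = barnes_ratio x * jacobi_norm x.
Proof.
move=> x0 xab0.
have a10 : 0 < a + 1 by rewrite -ltrBlDr sub0r.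
have b10 : 0 < b + 1 by rewrite -ltrBlDr sub0r.
have xa0 : 0 < x + a + 1 by lra.
have xb0 : 0 < x + b + 1 by lra.
have x10 : 0 < x + 1 by lra.
have y0 : 0 < 2 * x + a + b + 1 by lra.
have y1 : 0 < 2 * x + a + b + 2 by lra.
have E1 : barnesG (x + 1 + 1) = Gamma (x + 1) * barnesG (x + 1) by exact: barnesG_addr1.
have E2 : barnesG (x + 1 + a + 1) = Gamma (x + a + 1) * barnesG (x + a + 1).
  by apply: barnesG_addr1 => //; ring.
have E3 : barnesG (x + 1 + b + 1) = Gamma (x + b + 1) * barnesG (x + b + 1).
  by apply: barnesG_addr1 => //; ring.
have E4 : barnesG (x + 1 + a + b + 1) = Gamma (x + a + b + 1) * barnesG (x + a + b + 1).
  by apply: barnesG_addr1 => //; ring.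
have E5 : barnesG (2 * x + a + b + 2) = Gamma (2 * x + a + b + 1) * barnesG (2 * x + a + b + 1).
  by apply: barnesG_addr1 => //; ring.
have E6 : barnesG (2 * (x + 1) + a + b + 1) =
    Gamma (2 * x + a + b + 2) * barnesG (2 * x + a + b + 2).
  by apply: barnesG_addr1 => //; ring.
rewrite /barnes_ratio /jacobi_norm E1 E2 E3 E4 E6 E5.
have := barnesG_gt0 a10; have := barnesG_gt0 b10; have := barnesG_gt0 y0.
have := Gamma_gt0 y0; have := Gamma_gt0 y1.
move: (Gamma (2 * x + a + b + 2)) => g1 g10.
move: (Gamma (2 * x + a + b + 1)) => g2 g20.
move: (barnesG (2 * x + a + b + 1)) => g3 g30.
move: (barnesG (x + a + b + 1)) (Gamma (x + a + b + 1)) => h1 h2.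
move: (barnesG (x + a + 1)) (Gamma (x + a + 1)) => h3 h4.
move: (barnesG (x + b + 1)) (Gamma (x + b + 1)) => h5 h6.
move: (barnesG (x + 1)) (Gamma (x + 1)) => h7 h8.
move: (barnesG (b + 1)) => h9 h90; move: (barnesG (a + 1)) => h10 h100.
clear -g10 g20 g30 h90 h100.
by field; do ?(apply/andP; split); rewrite gt_eqF.
Qed.

Let op_norm0_barnes : op_norm M 0 = barnes_ratio 1.
Proof.
have a10 : 0 < a + 1 by rewrite -ltrBlDr sub0r.
have b10 : 0 < b + 1 by rewrite -ltrBlDr sub0r.
have y1 : 0 < a + b + 2 by lra.
have E1 : barnesG (1 + 1) = 1 :> R by rewrite (barnesG_addr1 ltr01 erefl) Gamma1 barnesG1 mulr1.
have E2 : barnesG (1 + a + 1) = Gamma (a + 1) * barnesG (a + 1).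
  by apply: barnesG_addr1 => //; ring.
have E3 : barnesG (1 + b + 1) = Gamma (b + 1) * barnesG (b + 1).
  by apply: barnesG_addr1 => //; ring.
have E4 : barnesG (1 + a + b + 1) = barnesG (a + b + 2) by congr barnesG; ring.
have E5 : barnesG (2 * 1 + a + b + 1) = Gamma (a + b + 2) * barnesG (a + b + 2).
  by apply: barnesG_addr1 => //; ring.
rewrite op_norm0 /barnes_ratio E1 E2 E3 E4 E5.
have := barnesG_gt0 a10; have := barnesG_gt0 b10; have := barnesG_gt0 y1.
have := Gamma_gt0 y1.
move: (Gamma (a + b + 2)) => g1 g10; move: (barnesG (a + b + 2)) => g2 g20.
move: (barnesG (b + 1)) => g3 g30; move: (barnesG (a + 1)) => g4 g40.
move: (Gamma (a + 1)) (Gamma (b + 1)) => h1 h2.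
move: g10 g20 g30 g40 => /lt0r_neq0 g10 /lt0r_neq0 g20 /lt0r_neq0 g30 /lt0r_neq0 g40.
by nonzero_field.
Qed.

(** One more norm multiplies the determinant by exactly the Gamma factors by which each G advances.
    The induction starts at n = 1 to keep every argument of G positive. *)
Lemma hankel_det0_barnesG n : (0 < n)%N -> hankel_det n 0 a b = barnes_ratio n%:R.
Proof.
case: n => [//|n] _; rewrite (hankel_detE a_gtN1 b_gtN1).
elim: n => [|n IH]; first by rewrite /op_hankel big_ord1 op_norm0_barnes.
rewrite op_hankelS IH.
by rewrite op_norm_jacobi -[n.+2%:R]natr1 barnes_ratioS//; exact: S_ab1_gt0.
Qed.

Lemma prod_Gamma_barnesG n (x : R) : 0 < x ->
  \prod_(j < n) Gamma (j%:R + x) = barnesG (n%:R + x) / barnesG x.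
Proof.
move=> x0; elim: n => [|n IH]; first by rewrite big_ord0 add0r divff// gt_eqF// barnesG_gt0.
rewrite big_ord_recr/= IH -natr1 addrAC barnesGS; first by rewrite mulrC mulrA.
by rewrite ltr_wpDl.
Qed.

Lemma Gamma_fact n : Gamma n.+1%:R = n`!%:R :> R.
Proof.
elim: n => [|n IH]; first by rewrite Gamma1.
by rewrite -natr1 GammaS// IH factS natrM.
Qed.

(** Deduced from the Barnes form, each product of Gamma values telescoping to a quotient of G. The
    product of Gamma(j+2) is G(n+2) = n! G(n+1), which explains the factor 1/n!. *)
Lemma hankel_det0_Gamma n : (0 < n)%N -> hankel_det n 0 a b =
  (n`!%:R)^-1 * \prod_(j < n) (Gamma (j%:R + 2) * Gamma (j%:R + a + 1)
    * Gamma (j%:R + b + 1) / Gamma (n%:R + j%:R + a + b + 1)).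
Proof.
move=> n0; rewrite hankel_det0_barnesG//.
have n1 : 1 <= n%:R :> R by rewrite ler1n.
have a10 : 0 < a + 1 by rewrite -ltrBlDr sub0r.
have b10 : 0 < b + 1 by rewrite -ltrBlDr sub0r.
have y0 : 0 < n%:R + a + b + 1 by lra.
have y1 : 0 < 2 * n%:R + a + b + 1 by lra.
have P1 : \prod_(j < n) Gamma (j%:R + 2) = n`!%:R * barnesG (n%:R + 1) :> R.
  rewrite (prod_Gamma_barnesG n (ltr0Sn _ 1)) (@barnesG_addr1 _ 2 1)//.
  rewrite Gamma1 barnesG1 mulr1 divr1 (@barnesG_addr1 _ _ (n%:R + 1)); last by ring.
    by rewrite natr1 Gamma_fact.
  by rewrite natr1.
have P2 : \prod_(j < n) Gamma (j%:R + a + 1) = barnesG (n%:R + a + 1) / barnesG (a + 1).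
  by under eq_bigr do rewrite -addrA; rewrite (prod_Gamma_barnesG n a10) addrA.
have P3 : \prod_(j < n) Gamma (j%:R + b + 1) = barnesG (n%:R + b + 1) / barnesG (b + 1).
  by under eq_bigr do rewrite -addrA; rewrite (prod_Gamma_barnesG n b10) addrA.
have P4 : \prod_(j < n) Gamma (n%:R + j%:R + a + b + 1) =
    barnesG (2 * n%:R + a + b + 1) / barnesG (n%:R + a + b + 1).
  rewrite (_ : 2 * n%:R + a + b + 1 = n%:R + (n%:R + a + b + 1)); last by ring.
  rewrite -(prod_Gamma_barnesG n y0); apply: eq_bigr => j _.
  by congr Gamma; ring.
rewrite !big_split/= prodfV P1 P2 P3 P4 /barnes_ratio; clear P1 P2 P3 P4.
have f0 : 0 < n`!%:R :> R by rewrite ltr0n fact_gt0.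
have := barnesG_gt0 a10; have := barnesG_gt0 b10.
have := barnesG_gt0 y0; have := barnesG_gt0 y1.
move: (n`!%:R) f0 => f f0.
move: (barnesG (2 * n%:R + a + b + 1)) => g1 g10.
move: (barnesG (n%:R + a + b + 1)) => g2 g20.
move: (barnesG (n%:R + a + 1)) => h1; move: (barnesG (n%:R + b + 1)) => h2.
move: (barnesG (n%:R + 1)) => h3.
move: (barnesG (b + 1)) => g3 g30; move: (barnesG (a + 1)) => g4 g40.
move: f0 g10 g20 => /lt0r_neq0 f0 /lt0r_neq0 g10 /lt0r_neq0 g20.
move: g30 g40 => /lt0r_neq0 g30 /lt0r_neq0 g40.
by nonzero_field.
Qed.

End JacobiHankel.

(** * The expansion at lambda = 0 *)

Section SmallLambda.
Context {R : realType} {a b : R}.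
Hypothesis a_gtN1 : -1 < a.
Hypothesis b_gtN1 : -1 < b.

Local Notation M := (moments_at (moment a b) 0).

Let m_pos p : p != 0 -> 0 < moment_functional M (p * p).
Proof. exact: moment_functional_gt0. Qed.

Let m_rec k : (a + 1 + k%:R) * M k = (a + b + 2 + k%:R) * M k.+1.
Proof. exact: moment0_rec. Qed.

Let op_beta_jac n (A : R) : A = 2 * n%:R + a + b -> A - 1 != 0 ->
  op_beta M n = jac_beta (a + b) (a - b) A.
Proof. by move=> -> h; exact: (jacobi_beta m_pos a_gtN1 b_gtN1 m_rec). Qed.

Let op_dalpha_jac n (A : R) : A = 2 * n.+1%:R + a + b -> A - 2 != 0 ->
  op_dalpha M n.+1 = jac_dalpha (a + b) (a - b) A.
Proof.
move=> -> h; apply: (jacobi_dalpha m_pos a_gtN1 b_gtN1 m_rec).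
by rewrite (_ : _ + b = 2 * n.+1%:R + a + b - 2)// -natr1; ring.
Qed.

Lemma hankel_det_taylor n : (0 < n)%N ->
  b1_den n a b != 0 -> b2_den n a b != 0 -> b3_den n a b != 0 ->
  b4_den n a b != 0 -> b5_den n a b != 0 ->
  exists r : R -> R, r =O_ (nbhs (0 : R)) (fun l : R => l ^+ 6) /\
    forall l, hankel_det n l a b = hankel_det n 0 a b *
      expR (b1 n a b * l + b2 n a b / 2 * l ^+ 2 + b3 n a b / 3 * l ^+ 3
        + b4 n a b / 4 * l ^+ 4 + b5 n a b / 5 * l ^+ 5 + r l).
Proof.
case: n => [//|n] _ n1 n2 n3 n4 n5.
have [r [C C0 rC] rE] := op_hankel_expansion (is_derive_moment a_gtN1 b_gtN1)
  (fun l p => @moment_functional_gt0 R a b a_gtN1 b_gtN1 l p) n.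
exists r; split.
  apply/eqOP; near=> k; apply: filterS rC => x; rewrite normrX => /le_trans; apply.
  by rewrite ler_wpM2r ?exprn_ge0//; near: k; exact: nbhs_pinfty_ge.
have := b2_cumulant n2; have := b3_cumulant n3.
have := b4_cumulant n4; have := b5_cumulant n5.
have := jacobi_subleading m_pos a_gtN1 b_gtN1 m_rec n.+1.
pose A : R := 2 * n.+1%:R + a + b; rewrite -/A.
have nA : A != 0 by exact: n1.
(* The factors of [b5_den] supply every condition used below: A - 1, A + 1, A - 3 for the three
   [op_beta], and A - 2, A, A - 4 for the three [op_dalpha]. *)
move: n5; rewrite /b5_den -/A !mulf_eq0 ?expf_eq0/= !negb_or => nz.
case/andP: nz => /andP[/andP[/andP[+ /andP[nAS _]] _] _] _.
case/andP => /andP[/andP[/andP[_ nA4] nA3] nA2] /andP[nA1 _].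
have bN : op_beta M n.+1 = jac_beta (a + b) (a - b) A := op_beta_jac erefl nA1.
have bS : op_beta M n.+2 = jac_beta (a + b) (a - b) (A + 2).
  apply: op_beta_jac; first by rewrite /A -[n.+2%:R]natr1; ring.
  by rewrite (_ : A + 2 - 1 = A + 1)//; ring.
have bP : op_beta M n = jac_beta (a + b) (a - b) (A - 2).
  apply: op_beta_jac; first by rewrite /A -natr1; ring.
  by rewrite (_ : A - 2 - 1 = A - 3)//; ring.
have dN : op_dalpha M n.+1 = jac_dalpha (a + b) (a - b) A := op_dalpha_jac erefl nA2.
have dS : op_dalpha M n.+2 = jac_dalpha (a + b) (a - b) (A + 2).
  by apply: op_dalpha_jac; [rewrite /A -[n.+2%:R]natr1; ring|rewrite addrK].
(* Only the product is identified: at n = 0 the placeholder [op_dalpha M 0] need not match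
   [jac_dalpha], but both sides vanish with [op_beta M 0]. *)
have bdP : op_beta M n * op_dalpha M n =
    jac_beta (a + b) (a - b) (A - 2) * jac_dalpha (a + b) (a - b) (A - 2).
  rewrite -bP; have [->|n_gt0] := posnP n; first by rewrite !mul0r.
  congr (_ * _); rewrite -(prednK n_gt0); apply: op_dalpha_jac.
    by rewrite prednK// /A -natr1; ring.
  by rewrite (_ : A - 2 - 2 = A - 4)//; ring.
move=> E1 E5 E4 E3 E2 l.
rewrite !(hankel_detE a_gtN1 b_gtN1) rE; congr (_ * expR _).
rewrite bdP bN bS bP dN dS E1.
rewrite -E5 -E4 -E3 -E2 /b1 /b1_den -/A.
move: (b2 _ _ _) (b3 _ _ _) (b4 _ _ _) (b5 _ _ _) => B2 B3 B4 B5.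
by rewrite [a + _]addrC; move: (_ / A) => B1; field.
Unshelve. all: by end_near.
Qed.

End SmallLambda.

Theorem theorem4p5 (R : realType) (n : nat) (alpha beta : R)
    (hn : (1 <= n)%N) (halpha : -1 < alpha) (hbeta : -1 < beta) :
  [/\ (forall lambda : R,
         hankel_det n lambda alpha beta =
         hankel_det n 0 alpha beta *
         expR (oriented_integral 0 lambda (fun s : R =>
           (- sigma n (- s) alpha beta - n%:R * s - n%:R * (n%:R + beta)) / s))),
      (b1_den n alpha beta != 0 -> b2_den n alpha beta != 0 ->
       b3_den n alpha beta != 0 -> b4_den n alpha beta != 0 ->
       b5_den n alpha beta != 0 ->
       exists r : R -> R,
         r =O_ (nbhs (0 : R)) (fun lambda : R => lambda ^+ 6) /\
         \forall lambda \near (0 : R),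
           hankel_det n lambda alpha beta =
           hankel_det n 0 alpha beta *
           expR (b1 n alpha beta * lambda
                 + b2 n alpha beta / 2 * lambda ^+ 2
                 + b3 n alpha beta / 3 * lambda ^+ 3
                 + b4 n alpha beta / 4 * lambda ^+ 4
                 + b5 n alpha beta / 5 * lambda ^+ 5
                 + r lambda)),
      hankel_det n 0 alpha beta =
        (n`!%:R)^-1 * \prod_(j < n)
          (Gamma (j%:R + 2) * Gamma (j%:R + alpha + 1)
             * Gamma (j%:R + beta + 1)
           / Gamma (n%:R + j%:R + alpha + beta + 1))
    & hankel_det n 0 alpha beta =
        barnesG (n%:R + 1) *
        (barnesG (n%:R + alpha + 1) * barnesG (n%:R + beta + 1)
           * barnesG (n%:R + alpha + beta + 1)
         / (barnesG (alpha + 1) * barnesG (beta + 1)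
              * barnesG (2 * n%:R + alpha + beta + 1)))].
Proof.
split.
- by move=> lambda; exact: hankel_det_exp_integral.
- move=> n1 n2 n3 n4 n5; have [r [r6 rE]] := hankel_det_taylor halpha hbeta hn n1 n2 n3 n4 n5.
  exists r; split; first exact: r6.
  exact (@nearW _ (nbhs (0 : R)) _ _ rE).
- exact: hankel_det0_Gamma.
- exact: hankel_det0_barnesG.
Qed.
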